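(* On the class of all finite structures, SO-EHORN$^{r}\equiv\Pi^1_1$.
   Context: All structures are finite; a vocabulary is a finite set of relation and constant symbols. SO-EHORN$^r$ (second-order extended revised Horn logic) is the set of second-order formulas of the form $\forall P_1\exists R_1\cdots\forall P_m\exists R_m\forall\bar x\,(C_1\wedge\cdots\wedge C_n)$, where $P_1,\dots,P_m,R_1,\dots,R_m$ are relation variables and each $C_j$ is an implication $\alpha_1\wedge\cdots\wedge\alpha_l\wedge\beta_1\wedge\cdots\wedge\beta_q\to H$ such that: each $\alpha_s$ is either an atomic formula $R_i\bar x$ or a formula $\forall\bar yR_i\bar y\bar z$; each $\beta_t$ is an atomic formula $Q\bar y$ or a negated atomic formula $\neg Q\bar y$ with $Q\notin\{R_1,\dots,R_m\}$; $H$ is an atomic formula $R_k\bar z$ or the Boolean constant $\bot$. $\Pi^1_1$ is the set of second-order formulas of the form $\forall X_1\cdots\forall X_k\,\psi$ with $\psi$ first-order. $\mathcal L_1\equiv\mathcal L_2$ means that every formula of either logic over a vocabulary $\tau$ has an equivalent formula of the other logic over $\tau$ (same finite models). *)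

(* Defs.v *)
From Stdlib Require List.
From HB Require Import structures.
From mathcomp Require Import all_boot.

Set Implicit Arguments.
Unset Strict Implicit.
Unset Printing Implicit Defensive.

Record vocabulary := Vocabulary {
  rel_sym : finType;
  rel_arity : rel_sym -> nat;
  cst_sym : finType
}.

(* A relation variable is a pair (name, arity): there are countably many
   relation variables of every arity. *)
Definition relvar : Type := (nat * nat)%type.
Definition arity (X : relvar) : nat := X.2.

Section Syntax.
Variable tau : vocabulary.

Inductive term := Var of nat | Cst of cst_sym tau.

Inductive formula :=
| Bot
| Eq of term & term
| Rel (r : rel_sym tau) of (rel_arity r).-tuple term
| RVar (X : relvar) of (arity X).-tuple term
| Neg of formula
| And of formula & formula
| Or of formula & formula
| Imp of formula & formula
| All of nat & formula
| Ex of nat & formula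
| AllR of relvar & formula
| ExR of relvar & formula.

Definition Top : formula := Neg Bot.
Definition conj (fs : seq formula) : formula := foldr And Top fs.
Definition alls (xs : seq nat) (f : formula) : formula := foldr All f xs.

Definition term_vars (t : term) : seq nat := if t is Var x then [:: x] else [::].

Fixpoint free_vars (f : formula) : seq nat :=
  match f with
  | Bot => [::]
  | Eq t u => term_vars t ++ term_vars u
  | Rel _ ts => flatten (map term_vars ts)
  | RVar _ ts => flatten (map term_vars ts)
  | Neg g => free_vars g
  | And g h | Or g h | Imp g h => free_vars g ++ free_vars h
  | All x g | Ex x g => [seq y <- free_vars g | y != x]
  | AllR _ g | ExR _ g => free_vars g
  end.

Fixpoint free_relvars (f : formula) : seq relvar :=
  match f with
  | Bot | Eq _ _ | Rel _ _ => [::]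
  | RVar X _ => [:: X]
  | Neg g => free_relvars g
  | And g h | Or g h | Imp g h => free_relvars g ++ free_relvars h
  | All _ g | Ex _ g => free_relvars g
  | AllR X g | ExR X g => [seq Y <- free_relvars g | Y != X]
  end.

Fixpoint first_order (f : formula) : bool :=
  match f with
  | Bot | Eq _ _ | Rel _ _ | RVar _ _ => true
  | Neg g | All _ g | Ex _ g => first_order g
  | And g h | Or g h | Imp g h => first_order g && first_order h
  | AllR _ _ | ExR _ _ => false
  end.

Definition pi11 (f : formula) : Prop :=
  exists (Xs : seq relvar) (psi : formula),
    first_order psi /\ f = foldr AllR psi Xs.

Section Clauses.
Variable Rs : seq relvar.

Inductive ehorn_alpha : formula -> Prop :=
| AlphaAtom (R : relvar) (ts : (arity R).-tuple term) :
    R \in Rs -> ehorn_alpha (RVar ts)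
| AlphaAll (R : relvar) (ts : (arity R).-tuple term)
    (ys : seq nat) (zs : seq term) :
    R \in Rs -> uniq ys ->
    (forall y, y \in ys -> y \notin flatten (map term_vars zs)) ->
    tval ts = map Var ys ++ zs ->
    ehorn_alpha (alls ys (RVar ts)).

(* Equality counts as one of the predicates Q outside Rs. *)
Inductive side_atom : formula -> Prop :=
| SideEq (t u : term) : side_atom (Eq t u)
| SideRel (r : rel_sym tau) (ts : (rel_arity r).-tuple term) :
    side_atom (Rel ts)
| SideRVar (Q : relvar) (ts : (arity Q).-tuple term) :
    Q \notin Rs -> side_atom (RVar ts).

Inductive ehorn_beta : formula -> Prop :=
| BetaPos (f : formula) : side_atom f -> ehorn_beta f
| BetaNeg (f : formula) : side_atom f -> ehorn_beta (Neg f).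

Inductive ehorn_head : formula -> Prop :=
| HeadAtom (R : relvar) (ts : (arity R).-tuple term) :
    R \in Rs -> ehorn_head (RVar ts)
| HeadBot : ehorn_head Bot.

Definition ehorn_clause (f : formula) : Prop :=
  exists (alphas betas : seq formula) (H : formula),
    [/\ List.Forall ehorn_alpha alphas,
        List.Forall ehorn_beta betas,
        ehorn_head H
      & f = Imp (conj (alphas ++ betas)) H].

End Clauses.

(* PRs lists the pairs (P_1, R_1), ..., (P_m, R_m) of the prefix. *)
Definition so_ehorn_r (f : formula) : Prop :=
  exists (PRs : seq (relvar * relvar)) (xs : seq nat) (Cs : seq formula),
    [/\ uniq (unzip1 PRs ++ unzip2 PRs),
        List.Forall (ehorn_clause (unzip2 PRs)) Cs
      & f = foldr (fun PR g => AllR PR.1 (ExR PR.2 g))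
                  (alls xs (conj Cs)) PRs].

Record structure := Structure {
  dom : finType;
  dom_nonempty : 0 < #|dom|;
  rel_int : forall r : rel_sym tau, {set (rel_arity r).-tuple dom};
  cst_int : cst_sym tau -> dom
}.

Section Semantics.
Variable A : structure.

Definition assignment := nat -> dom A.
Definition rel_assignment := forall X : relvar, {set (arity X).-tuple (dom A)}.

Definition term_val (s : assignment) (t : term) : dom A :=
  match t with Var x => s x | Cst c => cst_int A c end.

Fixpoint sat (s : assignment) (rho : rel_assignment) (f : formula) : Prop :=
  match f with
  | Bot => False
  | Eq t u => term_val s t = term_val s u
  | Rel r ts => map_tuple (term_val s) ts \in rel_int A r
  | RVar X ts => map_tuple (term_val s) ts \in rho X
  | Neg g => ~ sat s rho g
  | And g h => sat s rho g /\ sat s rho h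
  | Or g h => sat s rho g \/ sat s rho h
  | Imp g h => sat s rho g -> sat s rho h
  | All x g => forall a : dom A, sat (dfwith s (i := x) a) rho g
  | Ex x g => exists a : dom A, sat (dfwith s (i := x) a) rho g
  | AllR X g =>
      forall S : {set (arity X).-tuple (dom A)}, sat s (dfwith rho (i := X) S) g
  | ExR X g =>
      exists S : {set (arity X).-tuple (dom A)}, sat s (dfwith rho (i := X) S) g
  end.

End Semantics.

Definition equivalent (f g : formula) : Prop :=
  forall (A : structure) (s : assignment A) (rho : rel_assignment A),
    sat s rho f <-> sat s rho g.

(* The inclusions of free variables make a sentence correspond to a sentence
   with the same finite models. *)
Definition logic_le (L1 L2 : formula -> Prop) : Prop :=
  forall f, L1 f ->
    exists g, [/\ L2 g,
                  {subset free_vars g <= free_vars f},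
                  {subset free_relvars g <= free_relvars f}
                & equivalent f g].

Definition logic_equiv (L1 L2 : formula -> Prop) : Prop :=
  logic_le L1 L2 /\ logic_le L2 L1.

End Syntax.

(* Main.v *)
(** From Horn to [Pi^1_1], the quantifiers [exists R] are eliminated from the inside out. The
    invariant is that the matrix, once all the relations other than the remaining [R_i] are fixed,
    is a single ground Horn implication between facts about the [R_i]. For such matrices,
    [exists R, forall Z, chi R Z] fails iff facts [R a] can be derived one after the other, each
    by one violated instance [Z_a], until an instance is violated whatever [R] is. As there are
    only [|A|^k] facts, the instances form one relation per [Z] of arity increased by [k], so that
    the derivation is guessed by second-order quantifiers.

    Conversely, the truth of the first-order formula [~ psi] is derived by Horn clauses along its
    subformulas, the premises [forall y, R y z] taking care of the universal quantifiers, and the clause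
    [R_{~ psi} -> False] then expresses [psi]. *)

From Stdlib Require Import Classical.
Require Import Defs.
From mathcomp Require Import all_boot.

Set Implicit Arguments.
Unset Strict Implicit.
Unset Printing Implicit Defensive.

(** * Coincidence and quantifier blocks *)

(** The obstacle is an inner [exists R] in the scope of outer [R_i]: what replaces it must again be
    a single implication in these. In a refutation, the head of every instance but the last is used
    up by the fact about [R] that it derives, so such an instance constrains the outer relations
    only positively, through its body; only the last instance can keep a head. Together they thus
    have one joint body and at most one head, and the negation of the whole is a single implication
    again. Several clauses, or several values of a first-order variable, would give several
    implications; additional universally quantified relation variables therefore select one of them.

    In the other direction, Horn relations cannot be negated in a premise, so negations are pushed
    down to the atoms. The clauses are not recursive: the intended model is built one relation at a
    time, without fixed points. The strict alternation of the prefix is met by padding: the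
    variables of the given formula get dummy existential partners, the Horn relations dummy
    universal ones. *)

Section Basics.
Variable tau : vocabulary.
Implicit Types f g : formula tau.

Lemma map_term_val_ext (A : structure tau) (s s' : assignment A) n (ts : n.-tuple (term tau)) :
  {in flatten (map (@term_vars tau) ts), s =1 s'} ->
  map_tuple (term_val s) ts = map_tuple (term_val s') ts.
Proof.
move=> E; apply: val_inj => /=; elim: (tval ts) E => //= t l IH E.
congr (_ :: _); last by apply: IH => x xl; apply: E; rewrite mem_cat xl orbT.
by case: t E => //= x E; apply: E; rewrite mem_head.
Qed.

Lemma in_free_dfwith (A : structure tau) (s s' : assignment A) x a (l : seq nat) :
  {in [seq y <- l | y != x], s =1 s'} ->
  {in l, dfwith s (i := x) a =1 dfwith s' (i := x) a}.
Proof.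
move=> E y yl; have [<-|nxy] := eqVneq x y; first by rewrite !dfwith_in.
by rewrite !dfwith_out //; apply: E; rewrite mem_filter eq_sym nxy.
Qed.

Lemma in_free_dfwithR (A : structure tau) (rho rho' : rel_assignment A) X S l :
  (forall Y, Y \in [seq Y <- l | Y != X] -> rho Y = rho' Y) ->
  forall Y, Y \in l -> dfwith rho (i := X) S Y = dfwith rho' (i := X) S Y.
Proof.
move=> E Y Yl; have [<-|nXY] := eqVneq X Y; first by rewrite !dfwith_in.
by rewrite !dfwith_out //; apply: E; rewrite mem_filter eq_sym nXY.
Qed.

Lemma sat_ext (A : structure tau) f (s s' : assignment A) (rho rho' : rel_assignment A) :
  {in free_vars f, s =1 s'} ->
  (forall X, X \in free_relvars f -> rho X = rho' X) ->
  sat s rho f <-> sat s' rho' f.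
Proof.
elim: f s s' rho rho' => [|t u|r ts|X ts|g IH|g IH1 h IH2|g IH1 h IH2|g IH1 h IH2|
  x g IH|x g IH|X g IH|X g IH] s s' rho rho' /= Es Er //.
- have E v : {subset term_vars v <= term_vars t ++ term_vars u} ->
    term_val s v = term_val s' v.
    by case: v => //= x /(_ x); rewrite inE eqxx => /(_ isT) /Es.
  by rewrite !E // => x xv; rewrite mem_cat xv ?orbT.
- by rewrite (map_term_val_ext Es).
- by rewrite (map_term_val_ext Es) Er // inE.
- by rewrite IH; eauto.
1-3: by rewrite (IH1 s s' rho rho') ?(IH2 s s' rho rho') // => y yH; (apply: Es || apply: Er);
  rewrite mem_cat yH ?orbT.
- have E a := IH _ _ rho rho' (in_free_dfwith a Es) Er.
  by split=> H a; apply/E.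
- have E a := IH _ _ rho rho' (in_free_dfwith a Es) Er.
  by split=> -[a /E H]; exists a.
- have E S := IH _ _ _ _ Es (in_free_dfwithR S Er).
  by split=> H S; apply/E.
- have E S := IH _ _ _ _ Es (in_free_dfwithR S Er).
  by split=> -[S /E H]; exists S.
Qed.

Lemma sat_extW (A : structure tau) f (s s' : assignment A) (rho rho' : rel_assignment A) :
  sat s rho f -> {in free_vars f, s =1 s'} ->
  (forall X, X \in free_relvars f -> rho X = rho' X) -> sat s' rho' f.
Proof. by move=> H Es Er; apply/(sat_ext Es Er). Qed.

Definition agree_off (A : structure tau) (Xs : seq relvar) (rho rho' : rel_assignment A) :=
  forall X, X \notin Xs -> rho' X = rho X.

Lemma sat_alls (A : structure tau) (s : assignment A) rho xs f :
  sat s rho (alls xs f) <->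
  forall s', (forall x, x \notin xs -> s' x = s x) -> sat s' rho f.
Proof.
elim: xs s => [|x xs IH] s /=.
  split=> [H s' E|]; last by apply.
  by apply: sat_extW H _ _ => // x _; rewrite E.
split=> [H s' E | H a].
  have /IH := H (s' x); apply=> y yxs.
  have [<-|nxy] := eqVneq x y; first by rewrite dfwith_in.
  by rewrite dfwith_out // E // inE eq_sym negb_or nxy.
apply/IH => s' E; apply: H => y; rewrite inE negb_or eq_sym => /andP[nxy yxs].
by rewrite E // dfwith_out.
Qed.

Lemma sat_AllRs (A : structure tau) (s : assignment A) rho Xs f :
  sat s rho (foldr (@AllR tau) f Xs) <->
  forall rho', agree_off Xs rho rho' -> sat s rho' f.
Proof.
elim: Xs rho => [|X Xs IH] rho /=.
  split=> [H s' E|]; last by apply.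
  by apply: sat_extW H _ _ => // x _; rewrite E.
split=> [H rho' E | H S].
  have /IH := H (rho' X); apply=> Y YXs.
  have [<-|nXY] := eqVneq X Y; first by rewrite dfwith_in.
  by rewrite dfwith_out // E // inE eq_sym negb_or nXY.
apply/IH => rho' E; apply: H => Y; rewrite inE negb_or eq_sym => /andP[nXY YXs].
by rewrite E // dfwith_out.
Qed.

Lemma sat_conj (A : structure tau) (s : assignment A) rho fs :
  sat s rho (conj fs) <-> List.Forall (sat s rho) fs.
Proof.
elim: fs => [|f fs IH] /=; first by split=> [_|_ []]; constructor.
rewrite IH; split=> [[]|/List.Forall_cons_iff //]; first by constructor.
Qed.

Lemma mem_free_relvars_AllRs f Xs X :
  (X \in free_relvars (foldr (@AllR tau) f Xs)) =
  (X \in free_relvars f) && (X \notin Xs).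
Proof.
elim: Xs => [|Y Ys IH] /=; first by rewrite andbT.
by rewrite mem_filter IH inE negb_or andbCA.
Qed.

Lemma free_vars_AllRs f Xs :
  free_vars (foldr (@AllR tau) f Xs) = free_vars f.
Proof. by elim: Xs. Qed.

Lemma mem_free_vars_alls f xs x :
  (x \in free_vars (alls xs f)) = (x \in free_vars f) && (x \notin xs).
Proof.
elim: xs => [|y ys IH] /=; first by rewrite andbT.
by rewrite mem_filter IH inE negb_or andbCA.
Qed.

Lemma free_relvars_alls f xs : free_relvars (alls xs f) = free_relvars f.
Proof. by elim: xs. Qed.

Lemma first_order_alls f xs : first_order (alls xs f) = first_order f.
Proof. by elim: xs. Qed.

Lemma first_order_conj fs :
  List.Forall (@first_order tau) fs -> first_order (conj fs).
Proof. by elim=> // f fs' fo_f _ /= ->; rewrite fo_f. Qed.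

Lemma exists_fresh (T : eqType) (m : T -> nat) (l : seq T) :
  exists M, forall x, x \in l -> m x < M.
Proof.
elim: l => [|y l [M HM]]; first by exists 0.
exists (maxn (m y).+1 M) => x; rewrite inE => /orP[/eqP->|/HM lt_xM].
  exact: leq_maxl.
exact: leq_trans lt_xM (leq_maxr _ _).
Qed.

Lemma set_of_pred (T : finType) (P : T -> Prop) :
  exists S : {set T}, forall t, t \in S <-> P t.
Proof.
have /fin_all_exists[p Hp] (t : T) : exists b : bool, b <-> P t.
  by case: (classic (P t)) => H; [exists true | exists false].
by exists [set t | p t] => t; rewrite inE.
Qed.

(* Spurious free symbols of [g] are irrelevant to [f], so that they can be quantified universally. *)
Lemma pi11_close f g : pi11 g -> equivalent f g ->
  exists g', [/\ pi11 g', {subset free_vars g' <= free_vars f},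
    {subset free_relvars g' <= free_relvars f} & equivalent f g'].
Proof.
case=> Xs [psi [fo_psi ->]] eq_fg.
pose ev := [seq x <- free_vars psi | x \notin free_vars f].
pose g1 := foldr (@AllR tau) (alls ev psi) Xs.
pose er := [seq X <- free_relvars g1 | X \notin free_relvars f].
have eq1 : equivalent f g1.
  move=> A s rho; rewrite sat_AllRs; split=> [Hf rho' Er | H].
    apply/sat_alls => s' Es.
    have /eq_fg/sat_AllRs: sat s' rho f.
      apply: sat_extW Hf _ _ => // x xf; apply/esym/Es.
      by rewrite mem_filter xf.
    exact.
  apply/eq_fg/sat_AllRs => rho' Er.
  by have /sat_alls := H _ Er; apply.
exists (foldr (@AllR tau) g1 er); split.
- exists (er ++ Xs), (alls ev psi); rewrite first_order_alls; split=> //.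
  by rewrite foldr_cat.
- move=> x; rewrite free_vars_AllRs free_vars_AllRs mem_free_vars_alls.
  by rewrite mem_filter => /andP[->]; rewrite andbT negbK.
- move=> X; rewrite mem_free_relvars_AllRs mem_filter => /andP[->].
  by rewrite andbT negbK.
- move=> A s rho; rewrite sat_AllRs; split=> [Hf rho' Er | H].
    apply/eq1; apply: sat_extW Hf _ _ => // X Xf; rewrite Er //.
    by rewrite mem_filter Xf.
  by apply/eq1/H.
Qed.

End Basics.

(** * Derivations from ground Horn constraints *)

Section Refutation.
Variables (T : finType) (Z : Type) (chi : {set T} -> Z -> Prop).

(* [W] orders the derived elements [D]; the constraint [zz a] forces [a] once everything before [a] is
   derived, and the constraint [z0] is violated by every superset of [D]. *)
Definition refutation (D : {set T}) (W : rel T) (zz : T -> Z) (z0 : Z) :=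
  [/\ irreflexive W, transitive W,
      forall a, a \in D -> ~ chi [set b in D | W b a] (zz a) /\
                           chi (a |: [set b in D | W b a]) (zz a)
    & ~ chi D z0 /\ ~ chi setT z0].

(** A violated ground implication either has a head that no value of the relation supplies, which
    [~ chi setT z] expresses, or is repaired by adding its head [a]. *)
Hypothesis chi_step : forall z S, ~ chi S z ->
  ~ chi setT z \/ exists2 a, a \notin S & chi (a |: S) z.
Hypothesis chi_force : forall z (S S' : {set T}) a,
  ~ chi S z -> chi (a |: S) z -> S \subset S' -> chi S' z -> a \in S'.
Hypothesis chi_final : forall z (S S' : {set T}),
  ~ chi S z -> ~ chi setT z -> S \subset S' -> ~ chi S' z.

(** Any [S] that satisfies the instances [zz a] contains [D]: once the predecessors of [a] lie in
    [S], [chi_force] puts [a] there as well. As [T] is finite, the strict order [W] is well founded,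
    and the induction runs on the number of predecessors. *)
Lemma refutation_sound D W zz z0 S : refutation D W zz z0 ->
  (forall a, a \in D -> chi S (zz a)) -> ~ chi S z0.
Proof.
case=> irrW trW step [nD nT] HS; apply: (chi_final nD nT).
apply/subsetP => a; have [n] := ubnP #|[set b | W b a]|.
elim: n a => // n IH a lt_n aD; have [n1 n2] := step a aD.
apply: chi_force n1 n2 _ (HS a aD); apply/subsetP => b; rewrite inE => /andP[bD Wba].
apply: IH => //; move: lt_n; rewrite ltnS; apply: leq_trans; apply: proper_card.
apply/properP; split; first by apply/subsetP => c; rewrite !inE => /trW; apply.
by exists b; rewrite !inE ?irrW.
Qed.

(** Forward chaining: an instance violated at the current [D] either ends the derivation or yields a
    new fact. The rank [r] is the time of derivation; a new fact gets rank [#|D|], so that exactly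
    the earlier facts precede it. *)
Lemma refutation_complete : (forall S, exists z, ~ chi S z) ->
  exists D W zz z0, refutation D W zz z0.
Proof.
move=> nochi; have [z1 _] := nochi set0.
suff H n D (r : T -> nat) zz : #|~: D| <= n -> (forall b, b \in D -> r b < #|D|) ->
    (forall a, a \in D -> ~ chi [set b in D | r b < r a] (zz a) /\
                          chi (a |: [set b in D | r b < r a]) (zz a)) ->
    exists D' W zz' z0, refutation D' W zz' z0.
  by apply: (H _ set0 (fun=> 0) (fun=> z1) (leqnn _)) => b; rewrite inE.
elim: n D r zz => [|n IH] D r zz leDn ltr step.
all: have [z nDz] := nochi D; have [nTz|[a naD Ha]] := chi_step nDz.
1,3: exists D, (fun b a => r b < r a), zz, z; split=> // [b|b a c]; by [rewrite ltnn|apply: ltn_trans].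
  by move: leDn; rewrite leqn0 cards_eq0 => /eqP/setP/(_ a); rewrite !inE naD.
apply: (IH (a |: D) (fun x => if x == a then #|D| else r x) (fun x => if x == a then z else zz x)).
- by move: leDn; rewrite (cardsD1 a) inE naD add1n ltnS setCU setIC -setDE.
- move=> b; rewrite cardsU1 naD add1n !inE ltnS; case: eqP => //= _ /ltr; exact: ltnW.
- have neq b : b \in D -> (b == a) = false by move=> bD; apply: contraNF naD => /eqP<-.
  move=> b; rewrite !inE; have [->{b} _|nba /= bD] := eqVneq b a.
    suff -> : [set b in a |: D | (if b == a then #|D| else r b) < #|D|] = D by [].
    apply/setP => b; rewrite !inE; case: eqP => [->|_] /=; first by rewrite ltnn (negbTE naD).
    by apply: andb_idr => /ltr.
  suff -> : [set x in a |: D | (if x == a then #|D| else r x) < r b] = [set x in D | r x < r b].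
    exact: step.
  apply/setP => x; rewrite !inE; case: eqP => [->|_] //=.
  by rewrite (negbTE naD) ltnNge ltnW ?ltr.
Qed.

End Refutation.

(** * Second-order substitution *)

Section Substitution.
Variable tau : vocabulary.
Implicit Types f g : formula tau.

Fixpoint bound_vars f : seq nat :=
  match f with
  | Bot | Eq _ _ | Rel _ _ | RVar _ _ => [::]
  | Neg g => bound_vars g
  | And g h | Or g h | Imp g h => bound_vars g ++ bound_vars h
  | All x g | Ex x g => x :: bound_vars g
  | AllR _ g | ExR _ g => bound_vars g
  end.

Fixpoint fsubst (sg : forall X, (arity X).-tuple (term tau) -> formula tau) f : formula tau :=
  match f with
  | Bot => Bot tau
  | Eq t u => Eq t u
  | Rel r ts => Rel ts
  | RVar X ts => sg X ts
  | Neg g => Neg (fsubst sg g)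
  | And g h => And (fsubst sg g) (fsubst sg h)
  | Or g h => Or (fsubst sg g) (fsubst sg h)
  | Imp g h => Imp (fsubst sg g) (fsubst sg h)
  | All x g => All x (fsubst sg g)
  | Ex x g => Ex x (fsubst sg g)
  | AllR X g => AllR X (fsubst sg g)
  | ExR X g => ExR X (fsubst sg g)
  end.

Lemma first_order_fsubst sg f :
  (forall X ts, first_order (sg X ts)) -> first_order f -> first_order (fsubst sg f).
Proof.
move=> fo_sg; elim: f => //= g IHg h IHh /andP[/IHg-> /IHh->] //.
Qed.

(** The substituted formulas may use variables from [N] on as parameters; the quantifiers of [f]
    bind only variables below [N] and cannot capture them. Hence [M] has to be correct for all [s']
    that agree with [s] from [N] on. *)
Lemma sat_fsubst (A : structure tau) N sg f (s : assignment A) rho (M : rel_assignment A) :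
  first_order f -> {in bound_vars f, forall x, x < N} ->
  (forall s', (forall x, N <= x -> s' x = s x) -> forall X ts,
     sat s' rho (sg X ts) <-> map_tuple (term_val s') ts \in M X) ->
  sat s rho (fsubst sg f) <-> sat s M f.
Proof.
have catl (l m : seq nat) : {in l ++ m, forall x, x < N} -> {in l, forall x, x < N}.
  by move=> H x xl; apply: H; rewrite mem_cat xl.
have catr (l m : seq nat) : {in l ++ m, forall x, x < N} -> {in m, forall x, x < N}.
  by move=> H x xl; apply: H; rewrite mem_cat xl orbT.
have quant x g s' : {in x :: bound_vars g, forall y, y < N} ->
  (forall s'', (forall x, N <= x -> s'' x = s' x) -> forall X ts,
     sat s'' rho (sg X ts) <-> map_tuple (term_val s'') ts \in M X) ->
  forall a : dom A, forall s'', (forall y, N <= y -> s'' y = dfwith s' (i := x) a y) ->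
    forall X ts, sat s'' rho (sg X ts) <-> map_tuple (term_val s'') ts \in M X.
  move=> Hb H a s'' E; apply: H => y Ny; rewrite E // dfwith_out //.
  apply: contraTneq Ny => <-; rewrite -ltnNge; apply: Hb; exact: mem_head.
have tl x g : {in x :: bound_vars g, forall y, y < N} -> {in bound_vars g, forall y, y < N}.
  by move=> H y yg; apply: H; rewrite inE yg orbT.
elim: f s => [|t u|r ts|X ts|g IH|g IH1 h IH2|g IH1 h IH2|g IH1 h IH2|
  x g IH|x g IH|X g IH|X g IH] s //=.
- by move=> _ _; apply.
- by move=> fo Hb H; rewrite IH.
- move=> /andP[fo1 fo2] Hb H; rewrite IH1 ?IH2 //; [exact: catr Hb|exact: catl Hb].
- move=> /andP[fo1 fo2] Hb H; rewrite IH1 ?IH2 //; [exact: catr Hb|exact: catl Hb].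
- move=> /andP[fo1 fo2] Hb H; rewrite IH1 ?IH2 //; [exact: catr Hb|exact: catl Hb].
- move=> fo Hb H; have E a := IH _ fo (tl _ _ Hb) (quant _ _ _ Hb H a).
  by split=> K a; apply/E.
- move=> fo Hb H; have E a := IH _ fo (tl _ _ Hb) (quant _ _ _ Hb H a).
  by split=> -[a /E K]; exists a.
Qed.

(** The default [s x] of [nth] leaves the variables past the end of [t] unchanged. *)
Definition upd (D : Type) (s : nat -> D) N (t : seq D) x :=
  if N <= x then nth (s x) t (x - N) else s x.

Lemma upd_out D (s : nat -> D) N t x : x < N \/ N + size t <= x -> upd s N t x = s x.
Proof.
rewrite /upd; case: leqP => [Nx|//] [//|le_x].
by rewrite nth_default // leq_subRL.
Qed.

Definition varsT N k : k.-tuple (term tau) := [tuple Var tau (N + i) | i < k].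

Lemma map_varsT (A : structure tau) (s : assignment A) N k (t : k.-tuple (dom A)) :
  (forall i : 'I_k, s (N + i) = tnth t i) -> map_tuple (term_val s) (varsT N k) = t.
Proof. by move=> E; apply: eq_from_tnth => i; rewrite !tnth_map tnth_ord_tuple /= E. Qed.

Lemma upd_in D (s : nat -> D) N k (t : k.-tuple D) (i : 'I_k) : upd s N t (N + i) = tnth t i.
Proof.
rewrite /upd leq_addr addKn (tnth_nth (s (N + i))) //.
Qed.

Lemma sat_alls_iota (A : structure tau) (s : assignment A) rho N k f :
  sat s rho (alls (iota N k) f) <-> forall t : k.-tuple (dom A), sat (upd s N t) rho f.
Proof.
rewrite sat_alls; split=> [H t | H s' E].
  apply: H => x; rewrite mem_iota negb_and -ltnNge -leqNgt => Hx.
  by apply: upd_out; apply/orP; rewrite size_tuple.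
pose t := [tuple s' (N + i) | i < k].
apply: sat_extW (H t) _ _ => // x _.
case: (boolP (x \in iota N k)) => [|xN].
  rewrite mem_iota => /andP[Nx xk]; have xk' : x - N < k by rewrite ltn_subLR.
  by have := upd_in s N t (Ordinal xk'); rewrite tnth_map tnth_ord_tuple /= subnKC.
rewrite upd_out ?E //; apply/orP; rewrite size_tuple.
by move: xN; rewrite mem_iota negb_and -ltnNge -leqNgt.
Qed.

Definition eqs (ts us : seq (term tau)) : formula tau :=
  conj [seq Eq p.1 p.2 | p <- zip ts us].

Lemma sat_eqs (A : structure tau) (s : assignment A) rho k (ts us : k.-tuple (term tau)) :
  sat s rho (eqs ts us) <-> map_tuple (term_val s) ts = map_tuple (term_val s) us.
Proof.
have -> : (map_tuple (term_val s) ts = map_tuple (term_val s) us) <->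
          (map (term_val s) ts = map (term_val s) us).
  by split=> [/(congr1 val)|E]; last exact: val_inj.
have : size ts = size us by rewrite !size_tuple.
rewrite /eqs; elim: (tval ts) (tval us) => [|t l IH] [|u m] //=; first by split=> // _ [].
move/eqP; rewrite eqSS => /eqP/IH->; by split=> [[-> ->]|[-> ->]].
Qed.

Lemma first_order_eqs ts us : first_order (eqs ts us).
Proof. by rewrite /eqs; elim: (zip ts us). Qed.

End Substitution.

(** * Horn matrices *)

Section Horn.
Variable tau : vocabulary.
Implicit Types f g : formula tau.

(** Membership of untyped lists lets ground facts about relations of different arities share one
    type; a list of the wrong length belongs to no relation. *)
Definition inS (D : finType) k (S : {set k.-tuple D}) (l : seq D) :=
  [exists t in S, tval t == l].

Lemma inS_tval (D : finType) k (S : {set k.-tuple D}) (t : k.-tuple D) : inS S t = (t \in S).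
Proof.
apply/exists_inP/idP => [[u uS /eqP/val_inj<-] //|tS]; by exists t.
Qed.

Lemma inSP (D : finType) k (S : {set k.-tuple D}) l :
  reflect (exists2 t, t \in S & l = tval t) (inS S l).
Proof.
by apply: (iffP exists_inP) => -[t tS] => [/eqP<-|->]; exists t.
Qed.

Lemma inS_sub (D : finType) k (S S' : {set k.-tuple D}) l : S \subset S' -> inS S l -> inS S' l.
Proof. by move/subsetP => sub /inSP[t /sub tS' ->]; rewrite inS_tval. Qed.

Definition atom (A : structure tau) : Type := relvar * seq (dom A).

Definition body_in (A : structure tau) (B : relvar -> seq (dom A) -> Prop) (rho : rel_assignment A) :=
  forall X l, B X l -> inS (rho X) l.

Definition head_in (A : structure tau) (rho : rel_assignment A) (h : option (atom A)) : bool :=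
  if h is Some (X, l) then inS (rho X) l else false.

(* As a function of the relations in [Ro], with everything else fixed, [f] is a single
   ground Horn implication with body [B] and head [h], or is trivially true if [c] fails. *)
Definition horn (Ro : seq relvar) f :=
  forall (A : structure tau) (s : assignment A) (rho : rel_assignment A),
  exists c B h, forall rho', agree_off Ro rho rho' ->
    (~ sat s rho' f <-> [/\ c, body_in B rho' & ~~ head_in rho' h]).

Lemma horn_sub (Ro Ro' : seq relvar) f : {subset Ro' <= Ro} -> horn Ro f -> horn Ro' f.
Proof.
move=> sub Hf A s rho; have [c [B [h H]]] := Hf A s rho.
exists c, B, h => rho' E; apply: H => X nX; apply: E; by apply: contra nX; apply: sub.
Qed.

Section Ground.
Variables (A : structure tau) (s : assignment A) (f : formula tau) (R : relvar).
Variables (z : rel_assignment A) (c : Prop) (B : relvar -> seq (dom A) -> Prop).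
Variable h : option (atom A).
Let T : finType := (arity R).-tuple (dom A).
Let chi (S : {set T}) := sat s (dfwith z S) f.
Hypothesis Hd : forall S : {set T},
  ~ chi S <-> [/\ c, body_in B (dfwith z S) & ~~ head_in (dfwith z S) h].

Lemma inS_dfwith_mono (S S' : {set T}) X l : S \subset S' ->
  inS (dfwith z S X) l -> inS (dfwith z S' X) l.
Proof.
move=> sub; have [<-|nRX] := eqVneq R X; last by rewrite !dfwith_out.
by rewrite !dfwith_in; apply: inS_sub.
Qed.

Lemma body_in_mono (S S' : {set T}) : S \subset S' ->
  body_in B (dfwith z S) -> body_in B (dfwith z S').
Proof. by move=> sub H X l /H; apply: inS_dfwith_mono. Qed.

Lemma head_in_mono (S S' : {set T}) : S \subset S' ->
  head_in (dfwith z S) h -> head_in (dfwith z S') h.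
Proof. by case: h => // -[X l]; apply: inS_dfwith_mono. Qed.

Lemma head_in_new (S : {set T}) a : head_in (dfwith z (a |: S)) h ->
  ~~ head_in (dfwith z S) h -> h = Some (R, tval a) /\ a \notin S.
Proof.
case: h => // -[X l] /=; have [<-{X}|nRX] := eqVneq R X; last by rewrite !dfwith_out // => ->.
rewrite !dfwith_in => /inSP[t] /[swap]->; rewrite inS_tval !inE => /orP[/eqP-> //|->//].
Qed.

(** Enlarging [S] keeps the body true, so only supplying the head can repair the implication. On the
    right, relations other than [R] occur only positively, in the body; the elimination relies on
    this to stay Horn. *)
Lemma ground_step_iff (S : {set T}) a : ~ chi S /\ chi (a |: S) <->
  [/\ c, h = Some (R, tval a), a \notin S & body_in B (dfwith z S)].
Proof.
split=> [[/Hd[Hc HB Hh] Ha]|[Hc Eh naS HB]].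
  have [|E naS] // := @head_in_new S a _ Hh.
  apply/negPn/negP => nh; suff: ~ chi (a |: S) by []; apply/Hd; split=> //.
  exact: body_in_mono (subsetU1 _ _) HB.
split; first by apply/Hd; split; rewrite ?Eh //= dfwith_in inS_tval.
by apply: NNPP => /Hd[_ _]; rewrite Eh /= dfwith_in inS_tval setU11.
Qed.

Lemma ground_step (S : {set T}) : ~ chi S ->
  ~ chi setT \/ exists2 a, a \notin S & chi (a |: S).
Proof.
move=> /[dup] nS /Hd[Hc HB Hh].
have [Hh'|Hh'] := boolP (head_in (dfwith z (i := R) setT) h); last first.
  by left; apply/Hd; split=> //; apply: body_in_mono HB; apply: subsetT.
right; case: h Hh Hh' Hd => // -[X l] /=.
have [<-|nRX] := eqVneq R X; last by rewrite !dfwith_out // => /negP.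
rewrite !dfwith_in => nl /inSP[a _ El] Hd'.
move: nl; rewrite El inS_tval => naS; exists a => //.
by apply: NNPP => /Hd'[_ _]; rewrite dfwith_in El inS_tval setU11.
Qed.

Lemma ground_force (S S' : {set T}) a :
  ~ chi S -> chi (a |: S) -> S \subset S' -> chi S' -> a \in S'.
Proof.
move=> nS Sa sub HS'; have [Hc Eh naS HB] := iffLR (ground_step_iff S a) (Logic.conj nS Sa).
apply/negPn/negP => naS'; suff: ~ chi S' by []; apply/Hd; split=> //.
  exact: body_in_mono sub HB.
by rewrite Eh /= dfwith_in inS_tval.
Qed.

Lemma ground_final (S S' : {set T}) : ~ chi S -> ~ chi setT -> S \subset S' -> ~ chi S'.
Proof.
move=> /Hd[Hc HB _] /Hd[_ _ nh] sub; apply/Hd; split=> //; first exact: body_in_mono sub HB.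
by apply: contra nh; apply: head_in_mono; apply: subsetT.
Qed.

(** The head, if any, is false even for the full [R]; so it is a false fact about another relation,
    or an ill-formed one about [R]. *)
Lemma ground_final_iff (S : {set T}) : ~ chi S /\ ~ chi setT <->
  [/\ c, body_in B (dfwith z S) & ~~ head_in (dfwith z (i := R) setT) h].
Proof.
split=> [[/Hd[Hc HB _] /Hd[]] //|[Hc HB Hh]].
split; apply/Hd; split=> //.
  by apply: contra Hh; apply: head_in_mono; apply: subsetT.
by apply: body_in_mono HB; apply: subsetT.
Qed.

End Ground.

Lemma horn_ground Ro R f (A : structure tau) (s : assignment A) (z : rel_assignment A) :
  horn (R :: Ro) f -> exists c B h, forall S : {set (arity R).-tuple (dom A)},
  ~ sat s (dfwith z S) f <-> [/\ c, body_in B (dfwith z S) & ~~ head_in (dfwith z S) h].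
Proof.
move=> /(_ A s z)[c [B [h H]]]; exists c, B, h => S; apply: H => X.
by rewrite inE negb_or eq_sym => /andP[nRX _]; rewrite dfwith_out.
Qed.

End Horn.

(** * Elimination of an existential relation quantifier *)

Lemma refutation_ext (T : finType) (Z Z' : Type) (chi : {set T} -> Z -> Prop)
    (chi' : {set T} -> Z' -> Prop) D W W' zz zz' z0 z0' :
  W =2 W' -> (forall S a, chi S (zz a) <-> chi' S (zz' a)) ->
  (forall S, chi S z0 <-> chi' S z0') ->
  refutation chi D W zz z0 -> refutation chi' D W' zz' z0'.
Proof.
move=> EW Ezz Ez0 [irr tr step [nD nT]]; split.
- by move=> a; rewrite -EW.
- by move=> b a c; rewrite -!EW; apply: tr.
- move=> a aD; have -> : [set b in D | W' b a] = [set b in D | W b a].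
    by apply/setP => b; rewrite !inE EW.
  by rewrite -!Ezz; apply: step.
- by rewrite -!Ez0.
Qed.

Section Elimination.
Variable tau : vocabulary.
Variables (chi : formula tau) (R : relvar) (Zs Ro : seq relvar) (N M : nat).
Let k := arity R.
Hypothesis fo_chi : first_order chi.
Hypothesis horn_chi : horn (R :: Ro) chi.
Hypothesis bound_lt : {in bound_vars chi, forall x, x < N}.
Hypothesis free_lt : {in free_vars chi, forall x, x < N}.
Hypothesis name_chi : forall X, X \in free_relvars chi -> X.1 < M.
Hypothesis name_Ro : forall X, X \in Ro -> X.1 < M.
Hypothesis R_Zs : R \notin Zs.

(** Stacks the values of [X] in all the instances: the first [k] coordinates hold the derived fact
    [a], the others a tuple of [X] in the instance of [a]. The names [M] and [M.+1] are left to
    [domvar] and [ordvar]. *)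
Definition hat (X : relvar) : relvar := (M.+2 + X.1, k + arity X).
Definition domvar : relvar := (M, k).
Definition ordvar : relvar := (M.+1, k + k).

Let av : k.-tuple (term tau) := varsT tau N k.
Let bv : k.-tuple (term tau) := varsT tau (N + k) k.
Let cv : k.-tuple (term tau) := varsT tau (N + k + k) k.

Definition slice (Zs' : seq relvar) (A : structure tau) (rho : rel_assignment A)
    (a : k.-tuple (dom A)) : rel_assignment A :=
  fun X => if X \in Zs' then [set t | cat_tuple a t \in rho (hat X)] else rho X.

Definition sigma (Zs' : seq relvar) (theta : forall X, (arity X).-tuple (term tau) -> formula tau)
    (X : relvar) (ts : (arity X).-tuple (term tau)) : formula tau :=
  if X == R then theta X ts
  else if X \in Zs' then RVar (X := hat X) (cat_tuple av ts) else RVar ts.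

(** This and the next three formulas are meant for [X = R], where [(M, arity X)] is [domvar];
    stating them for every [X] spares [sigma] a cast of [ts] along that equation. *)
Definition derived X (ts : (arity X).-tuple (term tau)) : formula tau :=
  RVar (X := (M, arity X)) ts.
Definition derived_below X (ts : (arity X).-tuple (term tau)) : formula tau :=
  And (derived ts) (RVar (X := (M.+1, arity X + k)) (cat_tuple ts av)).
Definition derived_upto X (ts : (arity X).-tuple (term tau)) : formula tau :=
  Or (eqs ts av) (derived_below ts).
Definition anything X (ts : (arity X).-tuple (term tau)) : formula tau := Top tau.

Definition ordat (u v : k.-tuple (term tau)) : formula tau := RVar (X := ordvar) (cat_tuple u v).

(** In the last two conjuncts the empty list given to [sigma] leaves the variables [Zs] in place:
    the final instance is read from them, while the instances of the steps are read from their [hat]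
    versions. *)
Definition refuted : formula tau :=
  conj [:: alls (iota N k) (Neg (ordat av av));
   alls (iota N k) (alls (iota (N + k) k) (alls (iota (N + k + k) k)
     (Imp (And (ordat av bv) (ordat bv cv)) (ordat av cv))));
   alls (iota N k) (Imp (derived (X := R) av)
     (And (Neg (fsubst (sigma Zs derived_below) chi)) (fsubst (sigma Zs derived_upto) chi)));
   Neg (fsubst (sigma [::] derived) chi); Neg (fsubst (sigma [::] anything) chi)].

Lemma map_cat_tuple (D E : Type) (F : D -> E) m n (u : m.-tuple D) (v : n.-tuple D) :
  map_tuple F (cat_tuple u v) = cat_tuple (map_tuple F u) (map_tuple F v).
Proof. by apply: val_inj; rewrite /= map_cat. Qed.

Lemma map_varsT_above (A : structure tau) (s s' : assignment A) N' n :
  (forall x, N' <= x -> s' x = s x) ->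
  map_tuple (term_val s') (varsT tau N' n) = map_tuple (term_val s) (varsT tau N' n).
Proof.
move=> E; apply: map_varsT => i; rewrite !tnth_map tnth_ord_tuple /=.
by apply: E; rewrite leq_addr.
Qed.

Lemma sat_sigma Zs' (theta : forall X, (arity X).-tuple (term tau) -> formula tau)
    (A : structure tau) (s : assignment A) rho (S : {set k.-tuple (dom A)}) :
  (forall s', (forall x, N <= x -> s' x = s x) -> forall ts : k.-tuple (term tau),
    sat s' rho (theta R ts) <-> map_tuple (term_val s') ts \in S) ->
  sat s rho (fsubst (sigma Zs' theta) chi) <->
  sat s (dfwith (slice Zs' rho (map_tuple (term_val s) av)) (i := R) S) chi.
Proof.
move=> Hth; apply: (sat_fsubst (N := N)) => // s' E X ts; rewrite /sigma.
case: eqP => [EX|/eqP nXR]; first by subst X; rewrite dfwith_in; apply: Hth.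
rewrite dfwith_out 1?eq_sym // /slice; case: ifP => // _ /=.
by rewrite inE map_cat_tuple (map_varsT_above _ E).
Qed.

Lemma sat_fresh (A : structure tau) (s : assignment A) rho (t : seq (dom A)) :
  sat (upd s N t) rho chi <-> sat s rho chi.
Proof.
by apply: sat_ext => // x /free_lt ltxN; rewrite upd_out //; left.
Qed.

Lemma map_av (A : structure tau) (s : assignment A) (a : k.-tuple (dom A)) :
  map_tuple (term_val (upd s N a)) av = a.
Proof. by apply: map_varsT => i; rewrite upd_in. Qed.

Lemma sat_refuted (A : structure tau) (s : assignment A) (rho : rel_assignment A) :
  sat s rho refuted <->
  refutation (fun S z => sat s (dfwith z (i := R) S) chi) (rho domvar)
    (fun b a => cat_tuple b a \in rho ordvar) (slice Zs rho) rho.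
Proof.
have E1 : sat s rho (alls (iota N k) (Neg (ordat av av))) <->
    irreflexive (fun b a => cat_tuple b a \in rho ordvar).
  rewrite sat_alls_iota; split=> [H a|H a] /=; have := H a; rewrite /= map_cat_tuple map_av.
    by move/negP/negbTE.
  by move->.
have E2 : sat s rho (alls (iota N k) (alls (iota (N + k) k) (alls (iota (N + k + k) k)
     (Imp (And (ordat av bv) (ordat bv cv)) (ordat av cv))))) <->
    transitive (fun b a => cat_tuple b a \in rho ordvar).
  have Ev (a b c : k.-tuple (dom A)) : let s' := upd (upd (upd s N a) (N + k) b) (N + k + k) c in
    [/\ map_tuple (term_val s') av = a, map_tuple (term_val s') bv = b
      & map_tuple (term_val s') cv = c].
    split; apply: map_varsT => i; last by rewrite upd_in.
      rewrite upd_out; last by left; rewrite -addnA ltn_add2l ltn_addr.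
      by rewrite upd_out ?upd_in //; left; rewrite ltn_add2l.
    by rewrite upd_out ?upd_in //; left; rewrite ltn_add2l.
  rewrite sat_alls_iota; split=> [H b a c Hab Hbc | H a].
    have /sat_alls_iota/(_ b)/sat_alls_iota/(_ c) /= := H a.
    by rewrite !map_cat_tuple; have [-> -> ->] := Ev a b c; apply.
  apply/sat_alls_iota => b; apply/sat_alls_iota => c /=.
  by rewrite !map_cat_tuple; have [-> -> ->] := Ev a b c; case; apply: H.
have E3 : sat s rho (alls (iota N k) (Imp (derived (X := R) av)
     (And (Neg (fsubst (sigma Zs derived_below) chi)) (fsubst (sigma Zs derived_upto) chi)))) <->
    forall a, a \in rho domvar ->
      let S := [set b in rho domvar | cat_tuple b a \in rho ordvar] in
      ~ sat s (dfwith (slice Zs rho a) (i := R) S) chi /\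
      sat s (dfwith (slice Zs rho a) (i := R) (a |: S)) chi.
  rewrite sat_alls_iota.
  suff E a : let S := [set b in rho domvar | cat_tuple b a \in rho ordvar] in
      sat (upd s N a) rho (Imp (derived (X := R) av)
     (And (Neg (fsubst (sigma Zs derived_below) chi)) (fsubst (sigma Zs derived_upto) chi))) <->
     (a \in rho domvar -> ~ sat s (dfwith (slice Zs rho a) (i := R) S) chi /\
      sat s (dfwith (slice Zs rho a) (i := R) (a |: S)) chi).
    by split=> H a; have [E' E''] := E a; [apply: E' | apply: E'']; apply: H.
  move=> S /=; rewrite map_av.
  have Eb s' : (forall x, N <= x -> s' x = upd s N a x) -> forall ts : k.-tuple (term tau),
      sat s' rho (derived_below (X := R) ts) <-> map_tuple (term_val s') ts \in S.
    move=> Es ts; rewrite /= map_cat_tuple (map_varsT_above _ Es) map_av inE.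
    by split=> /andP.
  rewrite (@sat_sigma _ _ _ _ _ S) // map_av sat_fresh.
  rewrite (@sat_sigma _ _ _ _ _ (a |: S)) ?map_av ?sat_fresh // => s' Es ts.
  have -> : sat s' rho (derived_upto (X := R) ts) <->
    sat s' rho (eqs ts av) \/ sat s' rho (derived_below (X := R) ts) by [].
  rewrite Eb // sat_eqs (map_varsT_above _ Es) map_av in_setU1.
  by split=> [[->|->]|/orP[/eqP|]]; rewrite ?eqxx ?orbT; auto.
have E4 (theta : forall X, (arity X).-tuple (term tau) -> formula tau)
    (S : {set k.-tuple (dom A)}) :
    (forall s', (forall x, N <= x -> s' x = s x) -> forall ts : k.-tuple (term tau),
    sat s' rho (theta R ts) <-> map_tuple (term_val s') ts \in S) ->
    sat s rho (fsubst (sigma [::] theta) chi) <-> sat s (dfwith rho (i := R) S) chi.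
  by move=> /(sat_sigma [::]) ->; apply: sat_ext => // X _; case: dfwithP.
have E5 : sat s rho (Neg (fsubst (sigma [::] derived) chi)) <->
   ~ sat s (dfwith rho (i := R) (rho domvar)) chi by rewrite /= (E4 derived (rho domvar)).
have E6 : sat s rho (Neg (fsubst (sigma [::] anything) chi)) <->
   ~ sat s (dfwith rho (i := R) setT) chi.
  by rewrite /= (E4 anything setT) // => s' _ ts; rewrite inE; split=> // _ [].
split; first by case=> /E1 ? [/E2 ? [/E3 ? [/E5 ? [/E6 ? _]]]].
by case=> /E1 ? /E2 ? /E3 ? [/E5 ? /E6 ?]; do 5!split=> //; case.
Qed.

Lemma first_order_refuted : first_order refuted.
Proof.
rewrite /refuted; apply: first_order_conj.
have H Zs' (theta : forall X, (arity X).-tuple (term tau) -> formula tau) :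
  (forall X ts, first_order (theta X ts)) ->
  first_order (fsubst (sigma Zs' theta) chi).
  move=> Hth; apply: first_order_fsubst => // X ts; rewrite /sigma.
  by case: ifP => // _; case: ifP.
by repeat constructor; rewrite ?first_order_alls /= ?H // => X ts; rewrite /= ?first_order_eqs.
Qed.

(** The variables [Zs] are kept, for the final instance. *)
Definition elim_vars : seq relvar := domvar :: ordvar :: map hat Zs ++ Zs.

Lemma elim_vars_name X : X.1 < M -> X \notin Zs -> X \notin elim_vars.
Proof.
move=> ltXM nXZ; rewrite !inE mem_cat !negb_or nXZ andbT; apply/and3P; split.
- by apply: contraTneq ltXM => ->; rewrite ltnn.
- by apply: contraTneq ltXM => ->; rewrite -leqNgt leqnSn.
- apply: contraTN ltXM => /mapP[Y _ ->]; rewrite -leqNgt /=.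
  by apply: leq_trans (leq_addr _ _); rewrite -addn2 leq_addr.
Qed.

(** * Encoding a refutation by relations *)

Definition merge (A : structure tau) (rho z : rel_assignment A) : rel_assignment A :=
  fun X => if X \in Zs then z X else rho X.

(* Hides the dependency of the type of [rho X] on [X], so that [X] can be rewritten. *)
Definition holds_at (A : structure tau) (rho : rel_assignment A) X (l : seq (dom A)) :=
  inS (rho X) l.

(** The tests on [X] are boolean and do not change the type of the result, so all tuples are
    compared as lists. The pair [(X.1 - M.+2, X.2 - k)] undoes [hat]. *)
Definition encode (A : structure tau) (rho z0 : rel_assignment A) (D : {set k.-tuple (dom A)})
    (W : rel (k.-tuple (dom A))) (zz : k.-tuple (dom A) -> rel_assignment A) :
    rel_assignment A :=
  fun X =>
    if X == domvar then [set t | inS D (tval t)]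
    else if X == ordvar then
      [set t | [exists b : k.-tuple (dom A), [exists a : k.-tuple (dom A),
        W b a && (tval t == b ++ a)]]]
    else if X \in map hat Zs then
      [set t | [exists a : k.-tuple (dom A),
        (take k (tval t) == a) && holds_at (zz a) (X.1 - M.+2, X.2 - k) (drop k (tval t))]]
    else if X \in Zs then z0 X else rho X.

Lemma encode_off (A : structure tau) (rho z0 : rel_assignment A) D W zz :
  agree_off elim_vars rho (encode rho z0 D W zz).
Proof.
move=> X; rewrite !inE mem_cat !negb_or /encode.
by case/and4P=> /negbTE-> /negbTE-> /negbTE-> /negbTE->.
Qed.

Lemma encode_domvar (A : structure tau) (rho z0 : rel_assignment A) D W zz :
  encode rho z0 D W zz domvar = D.
Proof. by apply/setP => t; rewrite /encode eqxx inE inS_tval. Qed.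

Lemma encode_ordvar (A : structure tau) (rho z0 : rel_assignment A) D W zz b a :
  (cat_tuple b a \in encode rho z0 D W zz ordvar) = W b a.
Proof.
rewrite /encode eqxx ifF ?inE; last by apply/eqP => -[/eqP]; rewrite eqn_leq ltnn.
apply/existsP/idP => [[b' /existsP[a' /andP[Wba]]]|Wba].
  by rewrite eqseq_cat ?size_tuple // => /andP[/eqP/val_inj-> /eqP/val_inj->].
by exists b; apply/existsP; exists a; rewrite Wba /=.
Qed.

Lemma encode_low (A : structure tau) (rho z0 : rel_assignment A) D W zz X :
  X.1 < M -> encode rho z0 D W zz X = merge rho z0 X.
Proof.
move=> ltXM; rewrite /merge; case: ifP => XZ; last first.
  by rewrite encode_off // elim_vars_name ?XZ.
rewrite /encode XZ ifF; last by apply/eqP => EX; rewrite EX ltnn in ltXM.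
rewrite ifF; last by apply/eqP => EX; move: ltXM; rewrite EX /= ltnNge leqnSn.
rewrite ifF //; apply/mapP => -[Y _ EX]; move: ltXM.
by rewrite EX ltnNge /= !addSn -addnS -addnS leq_addr.
Qed.

Lemma encode_slice (A : structure tau) (rho z0 : rel_assignment A) D W zz a X :
  X.1 < M -> slice Zs (encode rho z0 D W zz) a X = merge rho (zz a) X.
Proof.
move=> ltXM; rewrite /slice /merge; case: ifP => XZ; last first.
  by rewrite encode_low // /merge XZ.
apply/setP => t; rewrite inE /encode.
rewrite ifF; last by apply/eqP => -[/eqP]; rewrite addSn eqn_leq -addSn addSnnS ltnNge leq_addr.
rewrite ifF; last by apply/eqP => -[/eqP]; rewrite eqn_leq !addSn ltnNge leq_addr.
rewrite map_f // inE /= addKn addKn -surjective_pairing.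
rewrite take_size_cat ?size_tuple // drop_size_cat ?size_tuple //.
apply/existsP/idP => [[a' /andP[/eqP/val_inj<-]]|tz]; first by rewrite /holds_at inS_tval.
by exists a; rewrite eqxx /holds_at inS_tval.
Qed.

Lemma elim_equivalent f : equivalent f (foldr (@AllR tau) chi Zs) ->
  equivalent (ExR R f) (foldr (@AllR tau) (Neg refuted) elim_vars).
Proof.
move=> eqf A s rho.
rewrite sat_AllRs; split=> [[S /eqf/sat_AllRs HS] rho' E' | H].
  move=> /sat_refuted ref.
  (* As [S] works for all values of [Zs], it satisfies every instance; [z] is also free on the names
     from [M] on, which do not occur free in [chi]. *)
  have chiS z : (forall X, X.1 < M -> X \notin Zs -> z X = rho X) ->
      sat s (dfwith z (i := R) S) chi.
    move=> Ez.
    have : sat s (merge (dfwith rho (i := R) S) z) chi.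
      by apply: HS => X nXZ; rewrite /merge (negbTE nXZ).
    move/sat_extW; apply=> // X /name_chi ltXM; rewrite /merge.
    case: ifP => XZ; first by rewrite dfwith_out //; apply: contraNneq R_Zs => ->.
    have [<-|nRX] := eqVneq R X; first by rewrite !dfwith_in.
    by rewrite !dfwith_out // Ez ?XZ.
  have Erho X : X.1 < M -> X \notin Zs -> rho' X = rho X.
    by move=> ltXM nXZ; apply: E'; apply: elim_vars_name.
  apply: (refutation_sound (S := S) _ _ ref); last exact: chiS.
  - move=> z S1 S2 a; have [c [B [h Hd]]] := horn_ground s z horn_chi.
    exact: (ground_force Hd).
  - move=> z S1 S2; have [c [B [h Hd]]] := horn_ground s z horn_chi.
    exact: (ground_final Hd).
  - move=> a _; apply: chiS => X ltXM nXZ.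
    by rewrite /slice (negbTE nXZ) Erho.
apply: NNPP => nS.
(* Instances are whole relation assignments, of which [merge] retains only the values on [Zs]. *)
have nochi (S : {set k.-tuple (dom A)}) : exists z,
    ~ sat s (dfwith (merge rho z) (i := R) S) chi.
  apply: NNPP => nz; apply: nS; exists S; apply/eqf/sat_AllRs => rho' E'.
  apply: NNPP => nchi; apply: nz; exists rho' => H1; apply: nchi.
  apply: sat_extW H1 _ _ => // X _; have [<-|nRX] := eqVneq R X.
    by rewrite dfwith_in E' // dfwith_in.
  rewrite dfwith_out // /merge; case: ifP => // /negbT nXZ.
  by rewrite E' // dfwith_out.
have [|D [W [zz [z0 ref]]]] := refutation_complete _ nochi.
  move=> z S; have [c [B [h Hd]]] := horn_ground s (merge rho z) horn_chi.
  exact: (ground_step Hd).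
apply: (H (encode rho z0 D W zz)) (encode_off _ _ _ _ _) _.
apply/sat_refuted; rewrite encode_domvar.
apply: refutation_ext ref.
- by move=> b a; rewrite encode_ordvar.
- move=> S a; apply: sat_ext => // X /name_chi ltXM.
  have [<-|nRX] := eqVneq R X; first by rewrite !dfwith_in.
  by rewrite !dfwith_out // encode_slice.
- move=> S; apply: sat_ext => // X /name_chi ltXM.
  have [<-|nRX] := eqVneq R X; first by rewrite !dfwith_in.
  by rewrite !dfwith_out // encode_low.
Qed.

(** * The Horn invariant survives the elimination *)

Lemma body_in_dfwith (A : structure tau) (B : relvar -> seq (dom A) -> Prop)
    (z : rel_assignment A) (S : {set k.-tuple (dom A)}) :
  body_in B (dfwith z (i := R) S) <->
  (forall l, B R l -> inS S l) /\ (forall X l, X != R -> B X l -> inS (z X) l).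
Proof.
split=> [H|[H1 H2] X l]; first split=> [l /H|X l nXR /H].
- by rewrite dfwith_in.
- by rewrite dfwith_out // eq_sym.
have [<-|nRX] := eqVneq R X; first by rewrite dfwith_in; apply: H1.
by rewrite dfwith_out //; apply: H2; rewrite eq_sym.
Qed.

(** Once the relations outside [Ro] are fixed, so are [D], the order and the slices. The instances
    of the steps then contribute only bodies, by [ground_step_iff], and the final one a body and
    possibly a head, by [ground_final_iff]. *)
Lemma horn_elim : horn Ro (Neg refuted).
Proof.
move=> A s rho.
have /fin_all_exists[c /fin_all_exists[B /fin_all_exists[h Hd]]] (a : k.-tuple (dom A)) :=
  horn_chi s (slice Zs rho a).
have [c0 [B0 [h0 Hd0]]] := horn_chi s rho.
pose D : {set k.-tuple (dom A)} := rho domvar.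
pose W (b a : k.-tuple (dom A)) := cat_tuple b a \in rho ordvar.
pose S a := [set b in D | W b a].
(* The condition collects what is settled outside [Ro]: the order, the heads of the steps, and the
   parts of the bodies about [R] and about the slices of [Zs]. A final head about [R] must be false
   even for [setT], which only a list of the wrong length achieves. *)
exists [/\ irreflexive W, transitive W,
    forall a, a \in D -> [/\ c a, h a = Some (R, tval a), a \notin S a,
      forall l, B a R l -> inS (S a) l
    & forall X l, X \in Zs -> X != R -> B a X l -> inS (slice Zs rho a X) l]
  & [/\ c0, forall l, B0 R l -> inS D l
    & if h0 is Some (X, l) then (X == R) ==> ~~ inS (dfwith rho (i := R) setT X) l else true]].
(* The joint body. For the steps, [Zs] is excluded, since there its value is a slice and already
   treated in the condition; the final instance reads [Zs] directly. *)
exists (fun X l => X != R /\ (B0 X l \/ exists a, [/\ a \in D, X \notin Zs & B a X l])).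
exists (if h0 is Some (X, l) then if X == R then None else h0 else None).
move=> rho' E'.
(* The names of [Ro] are below [M], so [domvar], [ordvar] and all the [hat] variables stay fixed. *)
have high (Y : relvar) : M <= Y.1 -> rho' Y = rho Y.
  by move=> leM; apply: E'; apply: contraTN leM => /name_Ro; rewrite -ltnNge.
have EZ X a : X \in Zs -> slice Zs rho' a X = slice Zs rho a X.
  by move=> XZ; rewrite /slice XZ high // /= !addSnnS leq_addr.
have nZ X a : X \notin Zs -> slice Zs rho' a X = rho' X.
  by move=> /negbTE nXZ; rewrite /slice nXZ.
have Hda a S1 : ~ sat s (dfwith (slice Zs rho' a) (i := R) S1) chi <->
    [/\ c a, body_in (B a) (dfwith (slice Zs rho' a) (i := R) S1)
      & ~~ head_in (dfwith (slice Zs rho' a) (i := R) S1) (h a)].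
  apply: Hd => X; rewrite inE negb_or eq_sym => /andP[nRX nXRo].
  rewrite dfwith_out //; case: (boolP (X \in Zs)) => [|nXZ]; first exact: EZ.
  by rewrite nZ // E' // /slice (negbTE nXZ).
have Hd0' (S1 : {set k.-tuple (dom A)}) : ~ sat s (dfwith rho' (i := R) S1) chi <->
    [/\ c0, body_in B0 (dfwith rho' (i := R) S1) & ~~ head_in (dfwith rho' (i := R) S1) h0].
  apply: Hd0 => X; rewrite inE negb_or eq_sym => /andP[nRX nXRo].
  by rewrite dfwith_out // E'.
have -> : ~ sat s rho' (Neg refuted) <-> sat s rho' refuted.
  by rewrite /=; split; [apply: NNPP | move=> ?; apply].
rewrite sat_refuted (high domvar) ?(high ordvar) ?leqnSn // -/D -/W.
have step_iff a : ~ sat s (dfwith (slice Zs rho' a) (i := R) (S a)) chi /\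
      sat s (dfwith (slice Zs rho' a) (i := R) (a |: S a)) chi <->
    [/\ c a, h a = Some (R, tval a), a \notin S a, forall l, B a R l -> inS (S a) l
      & forall X l, X \in Zs -> X != R -> B a X l -> inS (slice Zs rho a X) l] /\
    (forall X l, X != R -> X \notin Zs -> B a X l -> inS (rho' X) l).
  rewrite (ground_step_iff (Hda a)).
  split=> [[Hc Hh naS /body_in_dfwith[H1 H2]]|[[Hc Hh naS H1 H2] H3]].
    split=> [|X l nXR nXZ BX]; last by rewrite -(nZ _ a) //; apply: H2.
    by split=> // X l XZ nXR BX; rewrite -EZ //; apply: H2.
  split=> //; apply/body_in_dfwith; split=> // X l nXR BX.
  case: (boolP (X \in Zs)) => XZ; first by rewrite EZ //; apply: H2.
  by rewrite nZ //; apply: H3.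
have final_iff : ~ sat s (dfwith rho' (i := R) D) chi /\ ~ sat s (dfwith rho' (i := R) setT) chi <->
    [/\ c0, forall l, B0 R l -> inS D l
      & if h0 is Some (X, l) then (X == R) ==> ~~ inS (dfwith rho (i := R) setT X) l else true]
    /\ (forall X l, X != R -> B0 X l -> inS (rho' X) l) /\
    ~~ head_in rho' (if h0 is Some (X, l) then if X == R then None else h0 else None).
  rewrite (ground_final_iff Hd0').
  have head_iff : ~~ head_in (dfwith rho' (i := R) setT) h0 <->
    (if h0 is Some (X, l) then (X == R) ==> ~~ inS (dfwith rho (i := R) setT X) l else true) /\
    ~~ head_in rho' (if h0 is Some (X, l) then if X == R then None else h0 else None).
    case: (h0) => [[X l]|] //=; have [->|nXR] := eqVneq X R; rewrite /= ?dfwith_in.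
      by split=> [|[]].
    by rewrite dfwith_out 1?eq_sym //; split=> [|[]].
  split=> [[Hc /body_in_dfwith[H1 H2] /head_iff[H3 H4]] //|[[Hc H1 H3] [H2 H4]]].
  by split=> //; [apply/body_in_dfwith | apply/head_iff].
split.
  case=> irr tr step /final_iff[H1 [H2 H3]].
  have step' a aD := iffLR (step_iff a) (step a aD).
  split=> //; first by split=> // a /step'[].
  by move=> X l [nXR [/H2|[a [/step'[_ H4] nXZ /H4]]]]; apply.
case=> -[irr tr step Hfin] HB Hh; split=> //.
  move=> a aD; apply/step_iff; split; first exact: step.
  by move=> X l nXR nXZ BX; apply: HB; split=> //; right; exists a.
by apply/final_iff; split=> //; split=> // X l nXR BX; apply: HB; split=> //; left.
Qed.

End Elimination.

(** * Horn clauses as Horn matrices *)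

Section HornClauses.
Variable tau : vocabulary.
Implicit Types f g : formula tau.

Definition horn_body (Ro : seq relvar) f :=
  forall (A : structure tau) (s : assignment A) (rho : rel_assignment A),
  exists c B, forall rho', agree_off Ro rho rho' -> (sat s rho' f <-> c /\ body_in B rho').

Lemma body_in_atom (A : structure tau) (rho : rel_assignment A) X (t : (arity X).-tuple (dom A)) :
  body_in (fun Y l => (Y, l) = (X, tval t)) rho <-> t \in rho X.
Proof.
by split=> [/(_ X (tval t) erefl)|tX Y l [-> ->]]; rewrite inS_tval.
Qed.

Lemma horn_body_RVar Ro X (ts : (arity X).-tuple (term tau)) : horn_body Ro (RVar ts).
Proof.
move=> A s rho; exists True, (fun Y l => (Y, l) = (X, tval (map_tuple (term_val s) ts))).
by move=> rho' _; rewrite body_in_atom /=; split=> [|[]].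
Qed.

(** A formula free of the relations in [Ro] has a fixed truth value, which becomes the condition
    [c]; this accounts for the side atoms, negated or not. *)
Lemma horn_body_const Ro f : (forall X, X \in free_relvars f -> X \notin Ro) -> horn_body Ro f.
Proof.
move=> dis A s rho; exists (sat s rho f), (fun _ _ => False) => rho' E'.
rewrite (@sat_ext _ _ f s s rho' rho) // => [|X /dis]; last exact: E'.
by split=> [H|[]//]; split.
Qed.

Lemma horn_body_And Ro f g : horn_body Ro f -> horn_body Ro g -> horn_body Ro (And f g).
Proof.
move=> Hf Hg A s rho; have [c [B H]] := Hf A s rho; have [c' [B' H']] := Hg A s rho.
exists (c /\ c'), (fun X l => B X l \/ B' X l) => rho' E' /=.
rewrite H // H' //; split=> [[[? HB] [? HB']]|[[? ?] HB]]; first by split=> // X l [/HB|/HB'].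
by split; split=> // X l BX; apply: HB; [left|right].
Qed.

(** Over a given structure, a universally quantified premise is a conjunction of ground facts and
    merely enlarges the body. So the premises [forall y, R y z] remain Horn. *)
Lemma horn_body_All Ro x f : horn_body Ro f -> horn_body Ro (All x f).
Proof.
move=> Hf A s rho.
have /fin_all_exists[c /fin_all_exists[B H]] a := Hf A (dfwith s (i := x) a) rho.
exists (forall a, c a), (fun X l => exists a, B a X l) => rho' E' /=.
split=> [Hs|[Hc HB] a].
  by split=> [a|X l [a BX]]; have [? HB] := iffLR (H a _ E') (Hs a) => //; apply: HB.
by apply/H => //; split=> // X l BX; apply: HB; exists a.
Qed.

Lemma horn_body_conj Ro fs : List.Forall (horn_body Ro) fs -> horn_body Ro (conj fs).
Proof.
elim=> [|f fs' Hf _ IH]; last exact: horn_body_And.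
exact: horn_body_const.
Qed.

Lemma ehorn_clause_horn Rs f : ehorn_clause Rs f -> first_order f /\ horn Rs f.
Proof.
case=> alphas [betas [H [Ha Hb Hh ->]]].
have body : List.Forall (fun f => first_order f /\ horn_body Rs f) (alphas ++ betas).
  apply/List.Forall_app; split; [apply: List.Forall_impl Ha | apply: List.Forall_impl Hb].
    move=> _ [R ts RRs|R ts ys zs RRs _ _ _]; first by split=> //; apply: horn_body_RVar.
    split; first by rewrite first_order_alls.
    by elim: ys => [|y ys IH] /=; [apply: horn_body_RVar | apply: horn_body_All].
  have side g : side_atom Rs g -> first_order g /\ (forall X, X \in free_relvars g -> X \notin Rs).
    by case=> // Q ts nQ; split=> // X; rewrite inE => /eqP->.
  by move=> _ [g /side[fo dis]|g /side[fo dis]]; split=> //; apply: horn_body_const.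
split=> /=.
  rewrite (first_order_conj (List.Forall_impl _ _ body)) /=; last by move=> g [].
  by case: Hh.
have {}body : horn_body Rs (conj (alphas ++ betas)).
  by apply: horn_body_conj; apply: List.Forall_impl body => g [].
move=> A s rho; have [c [B HB]] := body A s rho.
exists c, B; case: Hh => [R ts RRs|].
  exists (Some (R, tval (map_tuple (term_val s) ts))) => rho' E'.
  rewrite /head_in inS_tval /= HB //; split=> [nimp|[Hc Hbody nh] imp].
    have [Hc Hbody] : c /\ body_in B rho' by apply: NNPP => n; apply: nimp => /n.
    by split=> //; apply/negP => Hh; apply: nimp.
  by move/negP: nh; apply; apply: imp.
exists None => rho' E' /=; rewrite HB //; split=> [nimp|[Hc Hbody _]]; last by apply.
by have [] : c /\ body_in B rho' by apply: NNPP => n; apply: nimp => /n.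
Qed.

End HornClauses.

(** * Closure of the invariant under the prefix and the matrix *)

Section HornMatrices.
Variable tau : vocabulary.
Implicit Types f g : formula tau.

Definition pi11_horn (Ro : seq relvar) f := exists (Zs : seq relvar) (chi : formula tau),
  [/\ first_order chi, horn Ro chi, forall X, X \in Zs -> X \notin Ro
    & equivalent f (foldr (@AllR tau) chi Zs)].

Lemma pi11_horn_AllR Ro P f : P \notin Ro -> pi11_horn Ro f -> pi11_horn Ro (AllR P f).
Proof.
move=> nP [Zs [chi [fo hc dis eqf]]]; exists (P :: Zs), chi; split=> //.
  by move=> X; rewrite inE => /orP[/eqP->|/dis].
by move=> A s rho /=; split=> H S; apply/eqf/H.
Qed.

Lemma pi11_horn_ExR Ro R f : pi11_horn (R :: Ro) f -> pi11_horn Ro (ExR R f).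
Proof.
move=> [Zs [chi [fo hc dis eqf]]].
have [N HN] := exists_fresh id (bound_vars chi ++ free_vars chi).
have [M HM] := exists_fresh (fun X : relvar => X.1) (free_relvars chi ++ Ro).
have HM1 X : X \in free_relvars chi -> X.1 < M by move=> H; apply: HM; rewrite mem_cat H.
have HM2 X : X \in Ro -> X.1 < M by move=> H; apply: HM; rewrite mem_cat H orbT.
have R_Zs : R \notin Zs by apply/negP => /dis; rewrite mem_head.
have Ro_Zs X : X \in Zs -> X \notin Ro by move/dis; rewrite inE negb_or => /andP[].
have HN1 : {in bound_vars chi, forall x, x < N} by move=> x H; apply: HN; rewrite mem_cat H.
have HN2 : {in free_vars chi, forall x, x < N} by move=> x H; apply: HN; rewrite mem_cat H orbT.
exists (elim_vars R Zs M), (Neg (refuted chi R Zs N M)); split.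
- exact: first_order_refuted.
- exact: horn_elim.
- move=> X; rewrite !inE mem_cat => /or4P[/eqP->|/eqP->|/mapP[Y _ ->]|/Ro_Zs //].
  + by apply/negP => /HM2; rewrite ltnn.
  + by apply/negP => /HM2; rewrite ltnNge leqnSn.
  + by apply/negP => /HM2; rewrite ltnNge /= !addSnnS leq_addr.
- exact: elim_equivalent.
Qed.

(* A first-order variable is replaced by a unary relation variable ranging over singletons, so that
   a fixed choice of the second-order variables leaves a single Horn implication. *)
Lemma pi11_horn_All Ro x f : pi11_horn Ro f -> pi11_horn Ro (All x f).
Proof.
move=> [Zs [chi [fo hc dis eqf]]].
have [M HM] := exists_fresh (fun X : relvar => X.1) (Zs ++ free_relvars chi ++ Ro).
pose X : relvar := (M, 1).
have fresh Y : Y \in Zs ++ free_relvars chi ++ Ro -> Y != X.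
  by move/HM; apply: contraTneq => ->; rewrite ltnn.
(* Says that [X] is the singleton of [x]; [x.+1] is just some variable other than [x]. *)
pose single := And (RVar (X := X) [tuple Var tau x])
  (All x.+1 (Imp (RVar (X := X) [tuple Var tau x.+1]) (Eq (Var tau x.+1) (Var tau x)))).
have nxx : x.+1 != x by rewrite eqn_leq ltnn.
have singleE (A : structure tau) (s : assignment A) rho a :
    sat (dfwith s (i := x) a) rho single <-> rho X = [set [tuple a]].
  rewrite /single /=.
  have E1 (u : dom A) b : map_tuple (term_val (dfwith (dfwith s (i := x) a) (i := x.+1) b))
      [tuple Var tau x.+1] = [tuple b] by apply: val_inj; rewrite /= dfwith_in.
  have -> : map_tuple (term_val (dfwith s (i := x) a)) [tuple Var tau x] = [tuple a].
    by apply: val_inj; rewrite /= dfwith_in.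
  split=> [[aX Ha]|EX].
    apply/setP => t; rewrite inE; apply/idP/eqP => [|->//].
    case/tupleP: t => b t; rewrite (tuple0 t) => bX.
    have := Ha b; rewrite E1 // => /(_ bX); rewrite dfwith_in dfwith_out // dfwith_in => ->.
    exact: val_inj.
  rewrite EX; split=> [|b]; first exact: set11.
  rewrite E1 // => /set1P[->].
  by rewrite dfwith_in dfwith_out // dfwith_in.
exists (X :: Zs), (All x (Imp single chi)); split=> //.
- move=> A s rho.
  case: (classic (exists a, rho X = [set [tuple a]])) => [[a EX]|nX].
    have [c [B [h H]]] := hc A (dfwith s (i := x) a) rho.
    exists c, B, h => rho' E'; rewrite -H //.
    have EX' : rho' X = [set [tuple a]].
      rewrite E' //; apply/negP => XRo; have /fresh : X \in Zs ++ free_relvars chi ++ Ro.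
        by rewrite !mem_cat XRo !orbT.
      by rewrite eqxx.
    suff -> : sat s rho' (All x (Imp single chi)) <-> sat (dfwith s (i := x) a) rho' chi by [].
    split=> [H1|H1 b Hb]; first by apply: (H1 a); apply/singleE.
    by have := iffLR (singleE _ _ _ _) Hb; rewrite EX' => /set1_inj[<-].
  (* If [X] is no singleton, [single] fails for every value of [x] and the matrix is trivially
     true. *)
  exists False, (fun _ _ => False), None => rho' E'; split=> [nH|[]//].
  case: nH => a Ha; case: nX; exists a; have := iffLR (singleE _ _ _ _) Ha; rewrite E' //.
  apply/negP => XRo; have /fresh : X \in Zs ++ free_relvars chi ++ Ro.
    by rewrite !mem_cat XRo !orbT.
  by rewrite eqxx.
- move=> Y; rewrite inE => /orP[/eqP->|/dis //]; apply/negP => XRo.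
  have /fresh : X \in Zs ++ free_relvars chi ++ Ro by rewrite !mem_cat XRo !orbT.
  by rewrite eqxx.
- move=> A s rho.
  have XZ : X \notin Zs.
    apply/negP => XZ; have /fresh : X \in Zs ++ free_relvars chi ++ Ro by rewrite mem_cat XZ.
    by rewrite eqxx.
  rewrite sat_AllRs; split=> [H rho' E' a Ha | H a].
    have /eqf/sat_AllRs/(_ (fun Y => if Y \in Zs then rho' Y else rho Y)) := H a.
    have E1 : agree_off Zs rho (fun Y => if Y \in Zs then rho' Y else rho Y).
      by move=> Y /negbTE->.
    move=> /(_ E1) H1; apply: sat_extW H1 _ _ => // Y Ychi; case: ifP => // /negbT YZ.
    by rewrite E' // inE negb_or YZ andbT fresh // !mem_cat Ychi orbT.
  apply/eqf/sat_AllRs => rho' E'.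
  have : sat (dfwith s (i := x) a) (dfwith rho' (i := X) [set [tuple a]]) chi.
    apply: (H (dfwith rho' (i := X) [set [tuple a]]) _ a); last by apply/singleE; rewrite dfwith_in.
    move=> Y; rewrite inE negb_or eq_sym => /andP[nXY nYZ].
    by rewrite dfwith_out // E'.
  move/sat_extW; apply=> // Y Ychi; rewrite dfwith_out // eq_sym fresh //.
  by rewrite !mem_cat Ychi orbT.
Qed.

(* The nullary relation variable [(M, 0)] selects one of the two conjuncts. *)
Lemma pi11_horn_conj Ro Cs : List.Forall (fun C => first_order C /\ horn Ro C) Cs ->
  pi11_horn Ro (conj Cs).
Proof.
move=> HCs; have [M HM] := exists_fresh (fun X : relvar => X.1) (free_relvars (conj Cs) ++ Ro).
(* For the induction, the selectors get names from [M] on: the one of the first clause is [M], those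
   of the remaining clauses are larger. *)
suff [Zs [chi [fo hc dis eqf]]] : exists (Zs : seq relvar) (chi : formula tau),
  [/\ first_order chi, horn Ro chi, forall X, X \in Zs -> M <= X.1
    & equivalent (conj Cs) (foldr (@AllR tau) chi Zs)].
  exists Zs, chi; split=> // X /dis leM; apply: contraTN leM => XRo.
  by rewrite -ltnNge HM // mem_cat XRo orbT.
elim: HCs M HM => [|C Cs' [foC hC] _ IH] M HM.
  exists [::], (Top tau); split=> // A s rho; exists False, (fun _ _ => False), None => rho' _.
  by split=> [H|[]//]; case: H => /= -[].
have HM' X : X \in free_relvars (conj Cs') ++ Ro -> X.1 < M.+1.
  move=> XH; apply: leqW; apply: HM => /=; rewrite -catA mem_cat XH orbT //.
have [Zs [chi [fo hc dis eqf]]] := IH _ HM'.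
pose B : relvar := (M, 0); pose Bat := RVar (tau := tau) (X := B) [tuple].
exists (B :: Zs), (And (Imp Bat C) (Imp (Neg Bat) chi)); split=> /=.
- by rewrite foC fo.
- move=> A s rho.
  have EB rho' : agree_off Ro rho rho' -> rho' B = rho B.
    by apply; apply/negP => BRo; have := HM B; rewrite mem_cat BRo orbT ltnn => /(_ isT).
  case: (boolP (map_tuple (term_val s) [tuple] \in rho B)) => HB.
    have [c [B' [h H]]] := hC A s rho; exists c, B', h => rho' E'; rewrite -H //= EB //.
    suff -> : (map_tuple (term_val s) [tuple] \in rho B -> sat s rho' C) /\
       (~ map_tuple (term_val s) [tuple] \in rho B -> sat s rho' chi) <-> sat s rho' C by [].
    by rewrite HB; split=> [[H1 _]|H1]; [apply: H1 | split].
  have [c [B' [h H]]] := hc A s rho; exists c, B', h => rho' E'; rewrite -H //= EB //.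
  suff -> : (map_tuple (term_val s) [tuple] \in rho B -> sat s rho' C) /\
     (~ map_tuple (term_val s) [tuple] \in rho B -> sat s rho' chi) <-> sat s rho' chi by [].
  by rewrite (negbTE HB); split=> [[_ H1]|H1]; [apply: H1 | split].
- by move=> X; rewrite inE => /orP[/eqP->//|/dis/ltnW].
- move=> A s rho.
  have BZ : B \notin Zs by apply/negP => /dis; rewrite ltnn.
  have Cfresh X : X \in free_relvars C -> X \notin B :: Zs.
    move=> XC; have ltXM : X.1 < M by apply: HM; rewrite mem_cat /= mem_cat XC.
    rewrite inE negb_or; apply/andP; split; first by apply: contraTneq ltXM => ->; rewrite ltnn.
    by apply: contraTN ltXM => /dis /ltnW; rewrite -leqNgt.
  have Cext rho' : agree_off (B :: Zs) rho rho' -> sat s rho C <-> sat s rho' C.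
    by move=> E'; apply: sat_ext => // X /Cfresh/E'->.
  have B_Cs X : X \in free_relvars (conj Cs') -> X != B.
    move=> XC; have ltXM : X.1 < M by apply: HM; rewrite mem_cat /= mem_cat XC orbT.
    by apply: contraTneq ltXM => ->; rewrite ltnn.
  have -> : sat s rho (AllR B (foldr (@AllR tau) (And (Imp Bat C) (Imp (Neg Bat) chi)) Zs)) <->
     sat s rho (foldr (@AllR tau) (And (Imp Bat C) (Imp (Neg Bat) chi)) (B :: Zs)) by [].
  rewrite sat_AllRs; split=> [[H1 H2] rho' E' | H].
    split=> /= [_|_]; first exact/(Cext _ E').
    have : sat s rho' (conj Cs').
      apply: sat_extW H2 _ _ => // X XC; rewrite E' // inE negb_or B_Cs //=.
      have ltXM : X.1 < M by apply: HM; rewrite mem_cat /= mem_cat XC orbT.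
      by apply: contraTN ltXM => /dis /ltnW; rewrite -leqNgt.
    by move/eqf/sat_AllRs; apply.
  (* The full nullary relation [B] selects [C], the empty one the remaining clauses. *)
  split.
    have E' : agree_off (B :: Zs) rho (dfwith rho (i := B) setT).
      by move=> X; rewrite inE negb_or eq_sym => /andP[nBX _]; rewrite dfwith_out.
    by apply/(Cext _ E'); case: (H _ E') => /= H1 _; apply: H1; rewrite dfwith_in inE.
  have : sat s (dfwith rho (i := B) set0) (conj Cs').
    apply/eqf/sat_AllRs => rho' E'.
    have [|/= _ H1] := H rho'.
      move=> X; rewrite inE negb_or eq_sym => /andP[nBX nXZ].
      by rewrite E' // dfwith_out.
    by apply: H1; rewrite E' // dfwith_in inE.
  by move/sat_extW; apply=> // X /B_Cs nXB; rewrite dfwith_out // eq_sym.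
Qed.

(** The clauses are Horn with respect to the complete list [Rs], while the induction on the prefix
    moves its relations into [Ro] one by one; hence the two lists are separate and related only by
    inclusion. *)
Lemma pi11_horn_ehorn Rs PRs Ro xs Cs :
  {subset unzip2 PRs ++ Ro <= Rs} -> (forall P, P \in unzip1 PRs -> P \notin Rs) ->
  List.Forall (ehorn_clause Rs) Cs ->
  pi11_horn Ro (foldr (fun PR g => AllR PR.1 (ExR PR.2 g)) (alls xs (conj Cs)) PRs).
Proof.
move=> + + HCs; elim: PRs Ro => [|[P R] PRs IH] Ro /= subR disP.
  elim: xs => [|x xs IHx] /=; last exact: pi11_horn_All.
  apply: pi11_horn_conj; apply: List.Forall_impl HCs => C /ehorn_clause_horn[foC hC].
  by split=> //; apply: horn_sub hC.
apply: pi11_horn_AllR.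
  have : P \notin Rs by apply: disP; rewrite mem_head.
  by apply: contra => PRo; apply: subR; rewrite inE mem_cat PRo !orbT.
apply: pi11_horn_ExR; apply: IH => [X|Q QP]; last by apply: disP; rewrite inE QP orbT.
by rewrite mem_cat inE => HX; apply: subR; rewrite inE mem_cat orbCA.
Qed.

Lemma so_ehorn_r_le_pi11 : logic_le (@so_ehorn_r tau) (@pi11 tau).
Proof.
move=> f [PRs [xs [Cs [uPR HCs Ef]]]].
have [||Zs [chi [fo _ _ eqf]]] := @pi11_horn_ehorn (unzip2 PRs) PRs [::] xs Cs _ _ HCs.
- by move=> X; rewrite cats0.
- move=> P P1; move: uPR; rewrite cat_uniq => /and3P[_ /hasPn nh _].
  by apply/negP => /nh /=; rewrite P1.
rewrite -Ef in eqf; apply: pi11_close eqf.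
by exists Zs, chi.
Qed.

End HornMatrices.

(** * Horn programs computing first-order formulas *)

Section Programs.
Variable tau : vocabulary.
Implicit Types f g : formula tau.
Variables (N c0 : nat) (V : seq nat) (Q : seq relvar).
Hypothesis V_lt : {in V, forall x, x < N}.
Hypothesis Q_lt : forall X, X \in Q -> X.1 < c0.

Definition query : Type := forall A : structure tau, assignment A -> rel_assignment A -> Prop.

(* The variables bound at depth [d] are [N + d - 1], ..., [N], innermost first. *)
Fixpoint ctx d : d.-tuple (term tau) :=
  if d is d'.+1 then cons_tuple (Var tau (N + d')) (ctx d') else [tuple].

Definition at_ctx r d : formula tau := RVar (X := (r, d)) (ctx d).

Definition ctx_val (A : structure tau) (s : assignment A) d : d.-tuple (dom A) :=
  map_tuple (term_val s) (ctx d).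

Lemma ctx_valS (A : structure tau) (s : assignment A) d :
  ctx_val s d.+1 = cons_tuple (s (N + d)) (ctx_val s d).
Proof. exact: val_inj. Qed.

Lemma ctx_val_ext (A : structure tau) (s s' : assignment A) d :
  (forall i, i < d -> s (N + i) = s' (N + i)) -> ctx_val s d = ctx_val s' d.
Proof.
elim: d => [|d IH] E; first exact: val_inj.
by rewrite !ctx_valS E // IH // => i ltid; apply: E; apply: ltnW.
Qed.

Lemma ctx_val_inj (A : structure tau) (s s' : assignment A) d :
  ctx_val s d = ctx_val s' d -> forall i, i < d -> s (N + i) = s' (N + i).
Proof.
elim: d => [|d IH] //; rewrite !ctx_valS => /(congr1 val) [E1 Ev] i.
have {Ev}/IH E2 : ctx_val s d = ctx_val s' d by apply: val_inj.
by rewrite ltnS leq_eqVlt => /orP[/eqP->|/E2].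
Qed.

Lemma ctx_vars d x : x \in flatten (map (@term_vars tau) (ctx d)) -> N <= x < N + d.
Proof.
elim: d => [|d IH] //=; rewrite inE => /orP[/eqP->|/IH/andP[-> lt]].
  by rewrite leq_addr addnS ltnSn.
by rewrite addnS ltnW.
Qed.

(** The variables below [N] are parameters of a program; its clauses are read as universally
    quantified over all the others. *)
Definition low_eq (A : structure tau) (s s' : assignment A) := forall x, x < N -> s' x = s x.

Definition local d (Phi : query) := forall A (s s' : assignment A) rho,
  (forall x, x < N + d -> s x = s' x) -> Phi A s rho -> Phi A s' rho.

Definition free_vars_ok (fs : seq (formula tau)) :=
  forall x, x \in free_vars (conj fs) -> x \in V \/ N <= x.

Definition free_relvars_ok (Rs : seq relvar) (fs : seq (formula tau)) :=
  forall X, X \in free_relvars (conj fs) -> X \in Rs \/ X \in Q.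

(** Being a Horn clause depends on the final list of existential relations, which is unknown while
    the program grows; so every larger list is allowed, as long as its names avoid the parameters
    [Q], all below [c0]. *)
Definition clauses_ok (Rs : seq relvar) (fs : seq (formula tau)) :=
  forall Rs' : seq relvar, {subset Rs <= Rs'} -> (forall X, X \in Rs' -> c0 <= X.1) ->
  List.Forall (ehorn_clause Rs') fs.

(* [defs r d Phi] says that the clauses derive [(r, d)] exactly where [Phi] holds: every model contains
   [Phi], and some model is contained in it. *)
Record program n (Rs : seq relvar) (Cs : seq (formula tau)) (defs : nat -> nat -> query -> Prop) :
    Prop := Program {
  prog_fresh : c0 <= n;
  prog_names : forall X, X \in Rs -> c0 <= X.1 < n;
  prog_uniq : uniq Rs;
  prog_clauses : clauses_ok Rs Cs;
  prog_vars : free_vars_ok Cs;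
  prog_relvars : free_relvars_ok Rs Cs;
  prog_defs : forall r d Phi, defs r d Phi -> (r, d) \in Rs /\ local d Phi;
  prog_sound : forall A (s : assignment A) rho,
    (forall s', low_eq s s' -> sat s' rho (conj Cs)) ->
    forall r d Phi, defs r d Phi -> forall s', low_eq s s' ->
    Phi A s' rho -> ctx_val s' d \in rho (r, d);
  prog_complete : forall A (s : assignment A) rho, exists rho',
    [/\ agree_off Rs rho rho', forall s', low_eq s s' -> sat s' rho' (conj Cs)
      & forall r d Phi, defs r d Phi -> forall s', low_eq s s' ->
        ctx_val s' d \in rho' (r, d) -> Phi A s' rho] }.

Lemma free_vars_conj_cat (fs gs : seq (formula tau)) :
  free_vars (conj (fs ++ gs)) = free_vars (conj fs) ++ free_vars (conj gs).
Proof. by elim: fs => //= f fs ->; rewrite catA. Qed.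

Lemma free_relvars_conj_cat (fs gs : seq (formula tau)) :
  free_relvars (conj (fs ++ gs)) = free_relvars (conj fs) ++ free_relvars (conj gs).
Proof. by elim: fs => //= f fs ->; rewrite catA. Qed.

Lemma sat_conj_cat (A : structure tau) (s : assignment A) rho fs gs :
  sat s rho (conj (fs ++ gs)) <-> sat s rho (conj fs) /\ sat s rho (conj gs).
Proof. by rewrite !sat_conj List.Forall_app. Qed.

Lemma program0 : program c0 [::] [::] (fun _ _ _ => False).
Proof.
split=> // A s rho; exists rho; by split=> // s' _ [].
Qed.

Definition extensible (defs : nat -> nat -> query -> Prop) d (Phi : query) :=
  exists n Rs Cs (defs' : nat -> nat -> query -> Prop),
    [/\ program n Rs Cs defs', forall r e Psi, defs r e Psi -> defs' r e Psi
      & exists r, defs' r d Phi].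

(** The old clauses do not mention the new relation [(n, d)]. Hence a model of them is extended by
    interpreting it as exactly [Phi], and only the new clauses [Cn] have to be examined. *)
Lemma program_extend n Rs Cs defs Cn d (Phi : query) :
  program n Rs Cs defs ->
  clauses_ok ((n, d) :: Rs) Cn -> free_vars_ok Cn -> free_relvars_ok ((n, d) :: Rs) Cn ->
  local d Phi ->
  (forall A (s : assignment A) rho, (forall s', low_eq s s' -> sat s' rho (conj Cn)) ->
    (forall r e Psi, defs r e Psi -> forall s', low_eq s s' ->
      Psi A s' rho -> ctx_val s' e \in rho (r, e)) ->
    forall s', low_eq s s' -> Phi A s' rho -> ctx_val s' d \in rho (n, d)) ->
  (forall A (s : assignment A) (rho rho' : rel_assignment A), (forall X, X \in Q -> rho X = rho' X) ->
    (forall r e Psi, defs r e Psi -> forall s', low_eq s s' ->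
      ctx_val s' e \in rho' (r, e) -> Psi A s' rho) ->
    (forall s', low_eq s s' -> ctx_val s' d \in rho' (n, d) <-> Phi A s' rho) ->
    forall s', low_eq s s' -> sat s' rho' (conj Cn)) ->
  extensible defs d Phi.
Proof.
move=> P Cok vok rok loc snd cmp.
have nRs e : (n, e) \notin Rs by apply/negP => /(prog_names P); rewrite ltnn andbF.
exists n.+1, ((n, d) :: Rs), (Cn ++ Cs),
  (fun r e Psi => defs r e Psi \/ [/\ r = n, e = d & Psi = Phi]).
split; last 2 first.
- by move=> r e Psi; left.
- by exists n; right.
split.
- exact: leqW (prog_fresh P).
- move=> X; rewrite inE => /orP[/eqP->|/(prog_names P)/andP[-> lt]] /=.
    by rewrite (prog_fresh P) ltnSn.
  exact: ltnW.
- by rewrite /= nRs (prog_uniq P).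
- move=> Rs' sub nam; apply/List.Forall_app; split; first exact: Cok.
  by apply: (prog_clauses P) => // X XRs; apply: sub; rewrite inE XRs orbT.
- move=> x; rewrite free_vars_conj_cat mem_cat => /orP[/vok //|/(prog_vars P) //].
- move=> X; rewrite free_relvars_conj_cat mem_cat => /orP[/rok //|/(prog_relvars P)[H|]].
    by left; rewrite inE H orbT.
  by right.
- move=> r e Psi [/(prog_defs P)[rR ?]|[-> -> ->]]; first by rewrite inE rR orbT.
  by rewrite mem_head.
- move=> A s rho H.
  have H1 s' (l : low_eq s s') := iffLR (sat_conj_cat _ _ _ _) (H s' l).
  have old : forall r e Psi, defs r e Psi -> forall s', low_eq s s' ->
      Psi A s' rho -> ctx_val s' e \in rho (r, e).
    by apply: (prog_sound P) => s' /H1[].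
  move=> r e Psi [/old //|[-> -> ->]].
  by apply: (snd A s rho) => // s' /H1[].
- move=> A s rho; have [rho1 [E1 HC Hdef]] := prog_complete P s rho.
  (* Since [Phi] is local, membership of [t] in [S] does not depend on the assignment [s'] that
     represents [t]. *)
  have [S HS] := set_of_pred (fun t => exists s', [/\ low_eq s s', ctx_val s' d = t & Phi A s' rho]).
  have Sval s' : low_eq s s' -> ctx_val s' d \in S <-> Phi A s' rho.
    move=> l; rewrite HS; split=> [[s'' [l' /ctx_val_inj Ev]]|Ph]; last by exists s'.
    apply: loc => x; case: (ltnP x N) => [ltx _|leN]; first by rewrite l // l'.
    by rewrite -{1}(subnKC leN) ltn_add2l => /Ev; rewrite subnKC.
  pose rho2 : rel_assignment A := dfwith rho1 (i := (n, d)) S.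
  have E2 X : X != (n, d) -> rho2 X = rho1 X by move=> nX; rewrite /rho2 dfwith_out // eq_sym.
  have olddef r e Psi : defs r e Psi -> rho2 (r, e) = rho1 (r, e).
    by move=> /(prog_defs P)[rR _]; rewrite E2 //; apply: contraTneq rR => ->; apply: nRs.
  have EQ X : X \in Q -> rho X = rho2 X.
    move=> /Q_lt ltX; rewrite E2; last first.
      by apply: contraTneq ltX => ->; rewrite -leqNgt (prog_fresh P).
    rewrite E1 //; apply/negP => /(prog_names P)/andP[leX _].
    by rewrite ltnNge leX in ltX.
  have Sval2 s' : low_eq s s' -> ctx_val s' d \in rho2 (n, d) <-> Phi A s' rho.
    by rewrite /rho2 dfwith_in; apply: Sval.
  have Hdef2 r e Psi : defs r e Psi -> forall s', low_eq s s' ->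
      ctx_val s' e \in rho2 (r, e) -> Psi A s' rho.
    by move=> dPsi; rewrite (olddef _ _ _ dPsi); apply: Hdef.
  exists rho2; split.
  + move=> X; rewrite inE negb_or => /andP[nX XRs]; rewrite E2 //; exact: E1.
  + move=> s' l; apply/sat_conj_cat; split; first exact: (cmp A s rho).
    apply: sat_extW (HC s' l) _ _ => // X /(prog_relvars P)[XRs|XQ].
      by rewrite E2 //; apply: contraTneq XRs => ->; apply: nRs.
    by rewrite -EQ // E1 //; apply/negP => /(prog_names P)/andP[]; rewrite leqNgt Q_lt.
  + by move=> r e Psi [|[-> -> ->]]; [apply: Hdef2 | move=> s' /Sval2 ->].
Qed.

Lemma low_eq_dfwith (A : structure tau) (s s' : assignment A) d a :
  low_eq s s' -> low_eq s (dfwith s' (i := N + d) a).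
Proof.
move=> l x ltxN; rewrite dfwith_out ?l //.
by apply: contraTneq ltxN => <-; rewrite -leqNgt leq_addr.
Qed.

Lemma ctx_val_dfwith (A : structure tau) (s : assignment A) d a :
  ctx_val (dfwith s (i := N + d) a) d = ctx_val s d.
Proof.
apply: ctx_val_ext => i ltid; rewrite dfwith_out // eqn_add2l.
by apply: contraTneq ltid => ->; rewrite ltnn.
Qed.

Lemma dfwith_level_ext (A : structure tau) (s s' : assignment A) d a :
  (forall x, x < N + d -> s x = s' x) ->
  forall x, x < N + d.+1 -> dfwith s (i := N + d) a x = dfwith s' (i := N + d) a x.
Proof.
move=> E x; rewrite addnS ltnS leq_eqVlt; have [->|nx /= /E] := eqVneq x (N + d).
  by rewrite !dfwith_in.
by rewrite !dfwith_out // eq_sym.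
Qed.

Lemma free_vars_at_ctx r d x : x \in free_vars (at_ctx r d) -> N <= x.
Proof. by move/ctx_vars => /andP[]. Qed.

(** * Clauses for the connectives, the quantifiers and the literals *)

Section Connectives.
Variables (n : nat) (Rs : seq relvar) (Cs : seq (formula tau)).
Variable defs : nat -> nat -> query -> Prop.
Hypothesis P : program n Rs Cs defs.

Lemma head_ok (Rs' : seq relvar) d : {subset (n, d) :: Rs <= Rs'} -> ehorn_head Rs' (at_ctx n d).
Proof. by move=> sub; constructor; apply: sub; rewrite mem_head. Qed.

Lemma alpha_ok (Rs' : seq relvar) d r e Psi : {subset (n, d) :: Rs <= Rs'} -> defs r e Psi ->
  ehorn_alpha Rs' (at_ctx r e).
Proof.
move=> sub /(prog_defs P)[rR _]; constructor; apply: sub; by rewrite inE rR orbT.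
Qed.

Lemma relvar_ok d r e Psi : defs r e Psi -> (r, e) \in (n, d) :: Rs.
Proof. by move=> /(prog_defs P)[rR _]; rewrite inE rR orbT. Qed.

Lemma program_and d r1 P1 r2 P2 : defs r1 d P1 -> defs r2 d P2 ->
  extensible defs d (fun A s rho => P1 A s rho /\ P2 A s rho).
Proof.
move=> D1 D2.
pose C := Imp (conj ([:: at_ctx r1 d; at_ctx r2 d] ++ [::])) (at_ctx n d).
apply: (program_extend (Cn := [:: C]) P).
- move=> Rs' sub _; constructor; last by [].
  exists [:: at_ctx r1 d; at_ctx r2 d], [::], (at_ctx n d).
  split=> //; last exact: head_ok.
  constructor; first exact: alpha_ok sub D1.
  by constructor; first exact: alpha_ok sub D2.
- move=> x; rewrite /= !cats0 !mem_cat -orbA.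
  by case/or3P => /ctx_vars/andP[leN _]; right.
- move=> X; rewrite /= !inE => /or3P[] /eqP->; left; rewrite ?eqxx //.
    exact: relvar_ok D1.
  exact: relvar_ok D2.
- move=> A s s' rho E [H1 H2]; split.
    exact: (proj2 (prog_defs P D1)) E H1.
  exact: (proj2 (prog_defs P D2)) E H2.
- move=> A s rho HC Hd s' l [H1 H2]; have [H _] := HC s' l; apply: H => /=.
  split; first exact: Hd D1 _ l H1.
  by split; [exact: Hd D2 _ l H2 | case].
- move=> A s rho rho' _ Hd Hn s' l; split=> [|[]]; case=> H1 [H2 _]; apply/Hn => //.
  by split; [exact: Hd D1 _ l H1 | exact: Hd D2 _ l H2].
Qed.

Lemma program_or d r1 P1 r2 P2 : defs r1 d P1 -> defs r2 d P2 ->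
  extensible defs d (fun A s rho => P1 A s rho \/ P2 A s rho).
Proof.
move=> D1 D2.
pose C r := Imp (conj ([:: at_ctx r d] ++ [::])) (at_ctx n d).
apply: (program_extend (Cn := [:: C r1; C r2]) P).
- move=> Rs' sub _; have Cok r Psi : defs r d Psi -> ehorn_clause Rs' (C r).
    move=> D; exists [:: at_ctx r d], [::], (at_ctx n d); split=> //; last exact: head_ok.
    by constructor; first exact: alpha_ok sub D.
  constructor; first exact: Cok D1.
  by constructor; first exact: Cok D2.
- move=> x; rewrite /= !cats0 !mem_cat -orbA.
  by case/or4P => /ctx_vars/andP[leN _]; right.
- move=> X; rewrite /= !inE => /or4P[] /eqP->; left; rewrite ?eqxx //.
    exact: relvar_ok D1.
  exact: relvar_ok D2.
- move=> A s s' rho E [H|H]; [left|right].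
    exact: (proj2 (prog_defs P D1)) E H.
  exact: (proj2 (prog_defs P D2)) E H.
- move=> A s rho HC Hd s' l; have [H1 [H2 _]] := HC s' l.
  case=> H; [apply: H1|apply: H2]; split; try by case.
    exact: Hd D1 _ l H.
  exact: Hd D2 _ l H.
- move=> A s rho rho' _ Hd Hn s' l; split; last split=> [|[]]; case=> H _; apply/Hn => //.
    by left; exact: Hd D1 _ l H.
  by right; exact: Hd D2 _ l H.
Qed.

(** The variable [N + d] occurs in the premise but not in the head, so the universal reading of the
    clause makes the premise existential. *)
Lemma program_ex d r P1 : defs r d.+1 P1 ->
  extensible defs d (fun A s rho => exists a, P1 A (dfwith s (i := N + d) a) rho).
Proof.
move=> D.
pose C := Imp (conj ([:: at_ctx r d.+1] ++ [::])) (at_ctx n d).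
apply: (program_extend (Cn := [:: C]) P).
- move=> Rs' sub _; constructor; last by [].
  exists [:: at_ctx r d.+1], [::], (at_ctx n d); split=> //; last exact: head_ok.
  by constructor; first exact: alpha_ok sub D.
- move=> x; rewrite /= !cats0 inE mem_cat => H; right.
  by case/or3P: H => [/eqP->|/ctx_vars/andP[]|/ctx_vars/andP[]] //; apply: leq_addr.
- move=> X; rewrite /= !inE => /orP[] /eqP->; left; rewrite ?eqxx //.
  exact: relvar_ok D.
- move=> A s s' rho E [a H]; exists a.
  exact: (proj2 (prog_defs P D)) (dfwith_level_ext a E) H.
- move=> A s rho HC Hd s' l [a H]; have l' := low_eq_dfwith d a l.
  have [HC' _] := HC _ l'; rewrite -(ctx_val_dfwith s' d a); apply: HC'.
  by split; [exact: Hd D _ l' H | case].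
- move=> A s rho rho' _ Hd Hn s' l; split=> [|[]]; case=> H _; apply/Hn => //.
  exists (s' (N + d)); apply: (proj2 (prog_defs P D)) (Hd _ _ _ D _ l H) => x _.
  by have [->|nx] := eqVneq x (N + d); rewrite ?dfwith_in // dfwith_out // eq_sym.
Qed.

Lemma program_all d r P1 : defs r d.+1 P1 ->
  extensible defs d (fun A s rho => forall a, P1 A (dfwith s (i := N + d) a) rho).
Proof.
move=> D.
pose C := Imp (conj ([:: alls [:: N + d] (at_ctx r d.+1)] ++ [::])) (at_ctx n d).
apply: (program_extend (Cn := [:: C]) P).
- move=> Rs' sub _; constructor; last by [].
  exists [:: alls [:: N + d] (at_ctx r d.+1)], [::], (at_ctx n d); split=> //; last exact: head_ok.
  (* Here it matters that [ctx] lists the innermost variable first: the quantified arguments must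
     precede the others. *)
  constructor => //; apply: (AlphaAll (zs := ctx d)) => //.
    by apply: sub; apply: relvar_ok D.
  by move=> y; rewrite inE => /eqP->; apply/negP => /ctx_vars; rewrite ltnn andbF.
- move=> x; rewrite /= eqxx /= !cats0 mem_cat mem_filter => H; right.
  by case/orP: H => [/andP[_]|] /ctx_vars/andP[].
- move=> X; rewrite /= !inE => /orP[] /eqP->; left; rewrite ?eqxx //.
  exact: relvar_ok D.
- move=> A s s' rho E H a.
  exact: (proj2 (prog_defs P D)) (dfwith_level_ext a E) (H a).
- move=> A s rho HC Hd s' l H; have [HC' _] := HC _ l; apply: HC'.
  split; last by case.
  by move=> a; apply: (Hd _ _ _ D _ (low_eq_dfwith d a l)); apply: H.
- move=> A s rho rho' _ Hd Hn s' l; split=> [|[]]; case=> H _; apply/Hn => // a.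
  by apply: (Hd _ _ _ D _ (low_eq_dfwith d a l)); apply: H.
Qed.

Lemma program_false d : extensible defs d (fun _ _ _ => False).
Proof.
by apply: (program_extend (Cn := [::]) P) => // A s rho rho' _ _ _ s' _ [].
Qed.

Lemma program_beta d (betas : seq (formula tau)) :
  (forall Rs' : seq relvar, (forall X, X \in Rs' -> c0 <= X.1) ->
     List.Forall (ehorn_beta Rs') betas) ->
  (forall x, x \in free_vars (conj betas) -> x \in V \/ N <= x < N + d) ->
  {subset free_relvars (conj betas) <= Q} ->
  extensible defs d (fun A s rho => sat s rho (conj betas)).
Proof.
move=> bok vok rok.
pose C := Imp (conj ([::] ++ betas)) (at_ctx n d).
apply: (program_extend (Cn := [:: C]) P).
- move=> Rs' sub nam; constructor; last by [].
  by exists [::], betas, (at_ctx n d); split=> //; [apply: bok | apply: head_ok].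
- move=> x; rewrite /= cats0 mem_cat => /orP[/vok[|/andP[? _]]|/(@free_vars_at_ctx n d)]; auto.
- move=> X; rewrite /= cats0 mem_cat inE => /orP[/rok|/eqP->]; auto.
  by left; rewrite mem_head.
- move=> A s s' rho E H; apply: sat_extW H _ _ => // x /vok[/V_lt ltxN|/andP[_ ltx]]; apply: E => //.
  exact: ltn_addr.
- by move=> A s rho HC _ s' l H; have [HC' _] := HC _ l; apply: HC'.
- move=> A s rho rho' EQ _ Hn s' l; split=> [H|[]]; apply/Hn => //.
  by apply: sat_extW H _ _ => // X /rok/EQ.
Qed.

End Connectives.

(** Truth and falsity of [f] are separate queries, as a relation derived by clauses cannot be
    negated in a premise. *)
Definition esem (b : bool) (e : nat -> nat) f : query :=
  fun A s rho => if b then sat (fun x => s (e x)) rho f else ~ sat (fun x => s (e x)) rho f.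

(** Quantifying over all programs allows the operands of a connective to be compiled one after the
    other into a common program. Asking only for a [Psi] pointwise equivalent to [Phi] avoids
    extensionality of queries. *)
Definition definable d (Phi : query) := forall n Rs Cs defs, program n Rs Cs defs ->
  exists n' Rs' Cs' (defs' : nat -> nat -> query -> Prop),
    [/\ program n' Rs' Cs' defs', forall r e Psi, defs r e Psi -> defs' r e Psi
      & exists r Psi, defs' r d Psi /\ forall A (s : assignment A) rho,
          Psi A s rho <-> Phi A s rho].

Lemma definable_equiv d (Phi Phi' : query) :
  (forall A (s : assignment A) rho, Phi A s rho <-> Phi' A s rho) ->
  definable d Phi -> definable d Phi'.
Proof.
move=> E D n Rs Cs defs /D[n' [Rs' [Cs' [defs' [P' sub [r [Psi [dr HPsi]]]]]]]].
exists n', Rs', Cs', defs'; split=> //; exists r, Psi; split=> // A s rho.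
by rewrite HPsi.
Qed.

Lemma definable_extensible d (Phi : query) :
  (forall n Rs Cs defs, program n Rs Cs defs -> extensible defs d Phi) -> definable d Phi.
Proof.
move=> E n Rs Cs defs /E[n' [Rs' [Cs' [defs' [P' sub [r dr]]]]]].
by exists n', Rs', Cs', defs'; split=> //; exists r, Phi.
Qed.

Lemma definable_binary d (op : Prop -> Prop -> Prop) (Phi1 Phi2 : query) :
  (forall p p' q q', (p <-> p') -> (q <-> q') -> (op p q <-> op p' q')) ->
  (forall n Rs Cs defs, program n Rs Cs defs -> forall r1 P1 r2 P2,
     defs r1 d P1 -> defs r2 d P2 ->
     extensible defs d (fun A s rho => op (P1 A s rho) (P2 A s rho))) ->
  definable d Phi1 -> definable d Phi2 ->
  definable d (fun A s rho => op (Phi1 A s rho) (Phi2 A s rho)).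
Proof.
move=> opE step D1 D2 n Rs Cs defs /D1[n1 [Rs1 [Cs1 [defs1 [P1 sub1 [r1 [Psi1 [d1 E1]]]]]]]].
have [n2 [Rs2 [Cs2 [defs2 [P2 sub2 [r2 [Psi2 [d2 E2]]]]]]]] := D2 _ _ _ _ P1.
have [n3 [Rs3 [Cs3 [defs3 [P3 sub3 [r3 d3]]]]]] := step _ _ _ _ P2 _ _ _ _ (sub2 _ _ _ d1) d2.
exists n3, Rs3, Cs3, defs3; split=> //; first by move=> r e Psi /sub1/sub2/sub3.
by eexists r3, _; split; first exact: d3; move=> A s rho /=; apply: opE.
Qed.

Lemma definable_and d (Phi1 Phi2 : query) : definable d Phi1 -> definable d Phi2 ->
  definable d (fun A s rho => Phi1 A s rho /\ Phi2 A s rho).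
Proof.
apply: definable_binary => [p p' q q' -> -> //|n Rs Cs defs P r1 P1 r2 P2 D1 D2].
exact: program_and P _ _ _ _ _ D1 D2.
Qed.

Lemma definable_or d (Phi1 Phi2 : query) : definable d Phi1 -> definable d Phi2 ->
  definable d (fun A s rho => Phi1 A s rho \/ Phi2 A s rho).
Proof.
apply: definable_binary => [p p' q q' -> -> //|n Rs Cs defs P r1 P1 r2 P2 D1 D2].
exact: program_or P _ _ _ _ _ D1 D2.
Qed.

Lemma definable_all d (Phi : query) : definable d.+1 Phi ->
  definable d (fun A s rho => forall a, Phi A (dfwith s (i := N + d) a) rho).
Proof.
move=> D n Rs Cs defs /D[n1 [Rs1 [Cs1 [defs1 [P1 sub1 [r1 [Psi1 [d1 E1]]]]]]]].
have [n3 [Rs3 [Cs3 [defs3 [P3 sub3 [r3 d3]]]]]] := program_all P1 d1.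
exists n3, Rs3, Cs3, defs3; split=> //; first by move=> r e Psi /sub1/sub3.
by eexists r3, _; split; first exact: d3; move=> A s rho /=; split=> H a; apply/E1.
Qed.

Lemma definable_ex d (Phi : query) : definable d.+1 Phi ->
  definable d (fun A s rho => exists a, Phi A (dfwith s (i := N + d) a) rho).
Proof.
move=> D n Rs Cs defs /D[n1 [Rs1 [Cs1 [defs1 [P1 sub1 [r1 [Psi1 [d1 E1]]]]]]]].
have [n3 [Rs3 [Cs3 [defs3 [P3 sub3 [r3 d3]]]]]] := program_ex P1 d1.
exists n3, Rs3, Cs3, defs3; split=> //; first by move=> r e Psi /sub1/sub3.
by eexists r3, _; split; first exact: d3; move=> A s rho /=; split=> -[a /E1 H]; exists a.
Qed.

Definition env_ok (e : nat -> nat) d f :=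
  forall x, x \in free_vars f -> e x \in V \/ N <= e x < N + d.

Lemma definable_atom d b e f f' :
  (forall Rs : seq relvar, (forall X, X \in Rs -> c0 <= X.1) -> side_atom Rs f') ->
  (forall x, x \in free_vars f' -> x \in V \/ N <= x < N + d) ->
  {subset free_relvars f' <= Q} ->
  (forall A (s : assignment A) rho, sat s rho f' <-> sat (fun x => s (e x)) rho f) ->
  definable d (esem b e f).
Proof.
move=> side vok rok E; apply: (@definable_equiv _
  (fun A s rho => sat s rho (conj [:: if b then f' else Neg f']))).
  by move=> A s rho; rewrite /esem; case: b => /=; rewrite -E; split=> [[]|] // H; split=> // -[].
apply: definable_extensible => n Rs Cs defs P; apply: (program_beta P).
- move=> Rs' nam; constructor; last by [].
  by case: b; constructor; apply: side.
- by move=> x; case: b; rewrite /= cats0; apply: vok.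
- by move=> X; case: b; rewrite /= cats0; apply: rok.
Qed.

Definition tren (e : nat -> nat) (t : term tau) : term tau := if t is Var x then Var tau (e x) else t.

Lemma term_val_tren (A : structure tau) (s : assignment A) e t :
  term_val s (tren e t) = term_val (fun x => s (e x)) t.
Proof. by case: t. Qed.

Lemma map_term_val_tren (A : structure tau) (s : assignment A) e m (ts : m.-tuple (term tau)) :
  map_tuple (term_val s) (map_tuple (tren e) ts) = map_tuple (term_val (fun x => s (e x))) ts.
Proof.
by apply: eq_from_tnth => i; rewrite !tnth_map term_val_tren.
Qed.

Lemma term_vars_tren e (ts : seq (term tau)) x :
  x \in flatten (map (@term_vars tau) (map (tren e) ts)) ->
  exists2 y, y \in flatten (map (@term_vars tau) ts) & x = e y.
Proof.
elim: ts => //= t ts IH; rewrite mem_cat => /orP[|/IH[y yts ->]].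
  case: t => //= y; rewrite inE => /eqP->; exists y => //; exact: mem_head.
by exists y => //; rewrite mem_cat yts orbT.
Qed.

(* Bound variables are renamed to de Bruijn levels above [N] by the environment [e]. *)
Lemma definable_formula f b e d : first_order f -> {subset free_relvars f <= Q} ->
  env_ok e d f -> definable d (esem b e f).
Proof.
have atoms g g' e' d' : env_ok e' d' g -> (forall x, x \in free_vars g' ->
    exists2 y, y \in free_vars g & x = e' y) ->
    forall x, x \in free_vars g' -> x \in V \/ N <= x < N + d'.
  by move=> env H x /H[y /env ? ->].
elim: f b e d => [|t u|r ts|X ts|g IH|g IHg h IHh|g IHg h IHh|g IHg h IHh|x g IH|x g IH|X g IH|X g IH]
  b e d //= fo rok env.
(* The truth of [Bot] gets no clause at all, its falsity a clause with empty body. *)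
- case: b; apply: definable_extensible => n Rs Cs defs P; first exact: program_false P _.
  by apply: (program_beta (betas := [::]) P) => // Rs' _; constructor.
- apply: (@definable_atom _ _ _ _ (Eq (tren e t) (tren e u))) => //.
  + by move=> Rs _; constructor.
  + apply: (atoms _ _ _ _ env) => x /=; have := @term_vars_tren e [:: t; u] x.
    by rewrite /= !cats0.
  + by move=> A s rho /=; rewrite !term_val_tren.
- apply: (@definable_atom _ _ _ _ (Rel (map_tuple (tren e) ts))) => //.
  + by move=> Rs _; constructor.
  + by apply: (atoms _ _ _ _ env) => x /=; apply: term_vars_tren.
  + by move=> A s rho /=; rewrite map_term_val_tren.
- apply: (@definable_atom _ _ _ _ (RVar (map_tuple (tren e) ts))) => //.
  + move=> Rs nam; constructor; apply/negP => /nam; rewrite leqNgt Q_lt //.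
    by apply: rok; rewrite mem_head.
  + by apply: (atoms _ _ _ _ env) => x /=; apply: term_vars_tren.
  + by move=> A s rho /=; rewrite map_term_val_tren.
- apply: definable_equiv (IH (~~ b) e d fo rok env) => A s rho; case: b => //=.
  by split=> [H|/NNPP].
all: try (have /andP[fog foh] := fo;
  have rokg : {subset free_relvars g <= Q} by move=> X XH; apply: rok; rewrite mem_cat XH);
  try (have rokh : {subset free_relvars h <= Q} by move=> X XH; apply: rok; rewrite mem_cat XH orbT);
  try (have envg : env_ok e d g by move=> x xH; apply: env; rewrite mem_cat xH);
  try (have envh : env_ok e d h by move=> x xH; apply: env; rewrite mem_cat xH orbT);
  try (have IHg' b' := IHg b' e d fog rokg envg; have IHh' b' := IHh b' e d foh rokh envh).
- case: b; first by apply: definable_equiv (definable_and (IHg' true) (IHh' true)) => A s rho.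
  apply: definable_equiv (definable_or (IHg' false) (IHh' false)) => A s rho; rewrite /esem /=.
  by split=> [[H|H] [Hg Hh]|/not_and_or]; auto.
- case: b; first by apply: definable_equiv (definable_or (IHg' true) (IHh' true)) => A s rho.
  apply: definable_equiv (definable_and (IHg' false) (IHh' false)) => A s rho; rewrite /esem /=.
  by split=> [[ng nh] [Hg|Hh]|/not_or_and]; auto.
- case: b.
    apply: definable_equiv (definable_or (IHg' false) (IHh' true)) => A s rho; rewrite /esem /=.
    by split=> [[H /H|]|/imply_to_or]; auto.
  apply: definable_equiv (definable_and (IHg' true) (IHh' false)) => A s rho; rewrite /esem /=.
  split=> [[Hg nh] H|H]; [exact: nh (H Hg) | exact: imply_to_and H].
all: have env' : env_ok (dfwith e (i := x) (N + d)) d.+1 g.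
1,3: move=> y yg; have [<-|nxy] := eqVneq x y.
1,3: by right; rewrite dfwith_in leq_addr addnS ltnSn.
1,2: rewrite dfwith_out //; have [|?|/andP[-> lt]] := env y; auto;
  [by rewrite mem_filter eq_sym nxy | by right; rewrite addnS ltnW].
(* On free variables other than [x], the values of [e] lie below [N + d], so the update at level
   [N + d] affects [x] alone. *)
all: have E A (s : assignment A) rho a :
    sat (fun y => dfwith s (i := N + d) a (dfwith e (i := x) (N + d) y)) rho g <->
    sat (dfwith (fun y => s (e y)) (i := x) a) rho g.
1,3: apply: sat_ext => // y yg; have [<-|nxy] := eqVneq x y; first by rewrite !dfwith_in.
1,2: rewrite [dfwith e _ y]dfwith_out // [RHS]dfwith_out // dfwith_out //; apply/eqP => Ey.
1,2: have [|/V_lt|/andP[_]] := env y; rewrite -?Ey ?ltnn // ?mem_filter 1?eq_sym ?nxy //.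
1,2: by rewrite ltnNge leq_addr.
all: have IH' b' := IH b' _ _ fo rok env'.
- case: b.
    by apply: definable_equiv (definable_all (IH' true)) => A s rho;
      rewrite /esem /=; split=> H a; apply/E/H.
  apply: definable_equiv (definable_ex (IH' false)) => A s rho; rewrite /esem /=.
  split=> [[a Ha] H|/not_all_ex_not[a Ha]]; first by apply: Ha; apply/E.
  by exists a => /E.
- case: b.
    by apply: definable_equiv (definable_ex (IH' true)) => A s rho;
      rewrite /esem /=; split=> -[a /E Ha]; exists a.
  apply: definable_equiv (definable_all (IH' false)) => A s rho; rewrite /esem /=.
  split=> [H [a /E Ha]|H a /E Ha]; first exact: H Ha.
  by apply: H; exists a.
Qed.

End Programs.

(** * Prefixes of the Horn logic *)

Lemma uniq_cat_lt (T : eqType) (m : T -> nat) k (l l' : seq T) :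
  uniq l -> uniq l' -> {in l, forall x, m x < k} -> {in l', forall x, k <= m x} ->
  uniq (l ++ l').
Proof.
move=> ul ul' lt_l ge_l'; rewrite cat_uniq ul ul' andbT; apply/hasPn => x /ge_l' /=.
by apply: contraTN => /lt_l; rewrite ltnNge.
Qed.

Section Prefix.
Variable tau : vocabulary.
Implicit Types f g : formula tau.

Definition so_prefix (PRs : seq (relvar * relvar)) f : formula tau :=
  foldr (fun PR g => AllR PR.1 (ExR PR.2 g)) f PRs.

Lemma free_vars_prefix PRs f : free_vars (so_prefix PRs f) = free_vars f.
Proof. by elim: PRs. Qed.

Lemma mem_free_relvars_prefix PRs f X : (X \in free_relvars (so_prefix PRs f)) =
  [&& X \in free_relvars f, X \notin unzip1 PRs & X \notin unzip2 PRs].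
Proof.
elim: PRs => [|[P R] PRs IH] /=; first by rewrite andbT.
rewrite !mem_filter IH !inE !negb_or /=.
by case: (X == P); case: (X == R); rewrite ?andbF.
Qed.

Lemma sat_ExRs (A : structure tau) (s : assignment A) rho Rs f :
  sat s rho (foldr (@ExR tau) f Rs) <-> exists2 rho', agree_off Rs rho rho' & sat s rho' f.
Proof.
elim: Rs rho => [|R Rs IH] rho /=.
  split=> [H|[rho' E H]]; first by exists rho.
  by apply: sat_extW H _ _ => // X _; rewrite E.
split=> [[S /IH[rho' E H]]|[rho' E H]].
  exists rho' => // X; rewrite inE negb_or eq_sym => /andP[nRX XRs].
  by rewrite E // dfwith_out.
exists (rho' R); apply/IH; exists rho' => // X XRs.
have [<-|nRX] := eqVneq R X; first by rewrite dfwith_in.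
by rewrite dfwith_out // E // inE negb_or eq_sym nRX.
Qed.

Lemma mem_free_relvars_ExRs f Rs X :
  X \in free_relvars (foldr (@ExR tau) f Rs) -> X \in free_relvars f.
Proof. by elim: Rs => //= R Rs IH; rewrite mem_filter => /andP[_ /IH]. Qed.

Lemma sat_fresh_dfwith (A : structure tau) (s : assignment A) rho X S f :
  X \notin free_relvars f -> sat s (dfwith rho (i := X) S) f <-> sat s rho f.
Proof.
move=> nX; apply: sat_ext => // Y Yf; rewrite dfwith_out //.
by apply: contraNneq nX => ->.
Qed.

Lemma sat_so_prefix_AllRs (A : structure tau) (s : assignment A) rho Xs ds f :
  size Xs = size ds -> (forall X, X \in ds -> X \notin free_relvars f) ->
  sat s rho (so_prefix (zip Xs ds) f) <-> sat s rho (foldr (@AllR tau) f Xs).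
Proof.
elim: Xs ds rho => [|X Xs IH] [|D ds] rho //= [Esz] fresh.
have IH' rho' : sat s rho' (so_prefix (zip Xs ds) f) <-> sat s rho' (foldr (@AllR tau) f Xs).
  by apply: IH => // Y Yds; apply: fresh; rewrite inE Yds orbT.
have nD : D \notin free_relvars (foldr (@AllR tau) f Xs).
  by rewrite mem_free_relvars_AllRs (negbTE (fresh D (mem_head _ _))).
split=> [H S|H S].
  by have [S' /IH'] := H S; rewrite sat_fresh_dfwith.
by exists set0; apply/IH'; rewrite sat_fresh_dfwith.
Qed.

Lemma sat_so_prefix_ExRs (A : structure tau) (s : assignment A) rho ps Rs f :
  size ps = size Rs -> (forall X, X \in ps -> X \notin free_relvars f) ->
  sat s rho (so_prefix (zip ps Rs) f) <-> sat s rho (foldr (@ExR tau) f Rs).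
Proof.
elim: ps Rs rho => [|P ps IH] [|R Rs] rho //= [Esz] fresh.
have IH' rho' : sat s rho' (so_prefix (zip ps Rs) f) <-> sat s rho' (foldr (@ExR tau) f Rs).
  by apply: IH => // Y Yps; apply: fresh; rewrite inE Yps orbT.
have nP : P \notin free_relvars (ExR R (foldr (@ExR tau) f Rs)).
  rewrite /= mem_filter negb_and; apply/orP; right.
  by apply: contra (fresh P (mem_head _ _)); apply: mem_free_relvars_ExRs.
split=> [/(_ set0)[S /IH' H]|H S].
  by apply/(sat_fresh_dfwith (X := P) s rho set0 nP); exists S.
have /(sat_fresh_dfwith s rho S nP)[S' HS'] := H.
by exists S'; apply/IH'.
Qed.

(* The clauses derive the negation of the matrix, and the last clause forbids to derive it. The
   positions of the prefix that are not needed are filled with fresh nullary variables. *)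
Lemma pi11_le_so_ehorn_r : logic_le (@pi11 tau) (@so_ehorn_r tau).
Proof.
move=> f [Xs [psi [fo_psi ->]]].
have [N HN] := exists_fresh id (free_vars psi).
have [c0 Hc0] := exists_fresh (fun X : relvar => X.1) (Xs ++ free_relvars psi).
pose V := free_vars psi; pose Q := free_relvars psi.
have V_lt : {in V, forall x, x < N} by move=> x /HN.
have Q_lt X : X \in Q -> X.1 < c0 by move=> XQ; apply: Hc0; rewrite mem_cat XQ orbT.
have env : env_ok N V (fun x => x) 0 psi by move=> x; left.
(* Polarity [false] at depth 0: the nullary relation [r] stands for the failure of [psi]. *)
have [n [Rs [Cs [defs [P _ [r [Psi [dr EPsi]]]]]]]] :=
  @definable_formula _ _ _ _ _ V_lt Q_lt psi false (fun x => x) 0 fo_psi (fun X XQ => XQ) env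
    _ _ _ _ (@program0 _ _ _ _ _).
pose C := Imp (conj ([:: at_ctx tau N r 0] ++ [::])) (Bot tau).
pose xs := [seq x <- free_vars (conj (C :: Cs)) | N <= x].
pose body := alls xs (conj (C :: Cs)).
(* The prefix of the Horn logic must be free of repetitions, whereas [Xs] need not be. *)
pose Xs0 := undup Xs.
(* The dummies [ds] are the existential partners of [Xs0], and [ps] the universal partners of [Rs];
   their names start at [n], above all names free in [body]. *)
pose ds : seq relvar := [seq (i, 0) | i <- iota n (size Xs0)].
pose ps : seq relvar := [seq (i, 0) | i <- iota (n + size Xs0) (size Rs)].
have [rR _] := prog_defs P dr.
have relC X : X \in free_relvars (conj (C :: Cs)) -> X \in Rs \/ X \in Q.
  rewrite /= inE => /orP[/eqP->|/(prog_relvars P) //]; by left.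
have ltn_n X : X \in Rs \/ X \in Q -> X.1 < n.
  case=> [/(prog_names P)/andP[] //|/Q_lt ltX]; exact: leq_trans ltX (prog_fresh P).
have ds_ge X : X \in ds -> n <= X.1 < n + size Xs0.
  by case/mapP => i; rewrite mem_iota => ? ->.
have ps_ge X : X \in ps -> n + size Xs0 <= X.1 < n + size Xs0 + size Rs.
  by case/mapP => i; rewrite mem_iota => ? ->.
have szds : size Xs0 = size ds by rewrite size_map size_iota.
have szps : size ps = size Rs by rewrite size_map size_iota.
have Xs_lt X : X \in Xs0 -> X.1 < c0.
  by rewrite mem_undup => XXs; apply: Hc0; rewrite mem_cat XXs.
have body_lt X : X \in free_relvars body -> X.1 < n.
  by rewrite free_relvars_alls => /relC/ltn_n.
have U1 : unzip1 (zip Xs0 ds ++ zip ps Rs) = Xs0 ++ ps.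
  by rewrite /unzip1 map_cat -!/(unzip1 _) !unzip1_zip // ?szds ?szps.
have U2 : unzip2 (zip Xs0 ds ++ zip ps Rs) = ds ++ Rs.
  by rewrite /unzip2 map_cat -!/(unzip2 _) !unzip2_zip // ?szds ?szps.
exists (so_prefix (zip Xs0 ds ++ zip ps Rs) body); split.
- exists (zip Xs0 ds ++ zip ps Rs), xs, (C :: Cs); split=> //.
    have inj0 : injective (fun i => (i, 0) : relvar) by move=> i j [].
    rewrite U1 U2.
    have -> : uniq ((Xs0 ++ ps) ++ ds ++ Rs) = uniq (Xs0 ++ Rs ++ ds ++ ps).
      apply: perm_uniq; apply/permP => a; rewrite !count_cat -!addnA; congr (_ + _).
      by rewrite addnC (addnC (count a ds)) addnA.
    have u_dp : uniq (ds ++ ps).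
      apply: (@uniq_cat_lt _ fst (n + size Xs0)); rewrite ?(map_inj_uniq inj0) ?iota_uniq //.
        by move=> X /ds_ge/andP[].
      by move=> X /ps_ge/andP[].
    have ge_dp X : X \in ds ++ ps -> n <= X.1.
      rewrite mem_cat => /orP[/ds_ge/andP[] //|/ps_ge/andP[leX _]].
      exact: leq_trans (leq_addr _ _) leX.
    apply: (@uniq_cat_lt _ fst c0) => //; first exact: undup_uniq.
      by apply: (@uniq_cat_lt _ fst n) => // [|X XR]; [exact: prog_uniq P | apply: ltn_n; left].
    move=> X; rewrite mem_cat => /orP[/(prog_names P)/andP[] //|/ge_dp].
    exact: leq_trans (prog_fresh P).
  rewrite U2.
  have sub : {subset Rs <= ds ++ Rs} by move=> X XR; rewrite mem_cat XR orbT.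
  constructor.
    exists [:: at_ctx tau N r 0], [::], (Bot tau); split=> //; last by constructor.
    by constructor=> //; constructor; apply: sub.
  apply: (prog_clauses P) => // X; rewrite mem_cat => /orP[/ds_ge/andP[leX _]|/(prog_names P)/andP[] //].
  exact: leq_trans (prog_fresh P) leX.
- move=> x; rewrite free_vars_prefix free_vars_AllRs mem_free_vars_alls mem_filter => /andP[xC].
  rewrite xC andbT -ltnNge => ltxN; move: xC; rewrite /= => /(prog_vars P)[//|].
  by rewrite leqNgt ltxN.
- move=> X; rewrite mem_free_relvars_prefix mem_free_relvars_AllRs U1 U2 !mem_cat !negb_or.
  rewrite free_relvars_alls mem_undup => /and3P[/relC[XR|->]]; last by case/andP=> -> _.
  by rewrite XR andbF.
- move=> A s rho.
  (* Only the variables from [N] on that occur free in the clauses are quantified, which amounts to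
     quantifying all variables from [N] on. *)
  have low_xs rho' : sat s rho' body <-> forall s', low_eq N s s' -> sat s' rho' (conj (C :: Cs)).
    rewrite sat_alls; split=> H s' E; last first.
      by apply: H => x ltxN; apply: E; rewrite mem_filter leqNgt ltxN.
    have : sat (fun x => if x \in xs then s' x else s x) rho' (conj (C :: Cs)).
      by apply: H => x /negbTE->.
    move/sat_extW; apply=> // x xC; rewrite mem_filter xC andbT.
    by case: leqP => // /E->.
  have goalC s' rho' : sat s' rho' C <-> ctx_val N s' 0 \notin rho' (r, 0).
    by rewrite /=; split=> [H|/negP H [/H]//]; apply/negP => H'; apply: H; split=> // -[].
  (* If [psi] holds, the model from [prog_complete] does not contain the goal fact, so it also
     satisfies [C]; if [psi] fails, every model of [Cs] contains it, by [prog_sound], and violates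
     [C]. *)
  have key rho1 : sat s rho1 psi <->
      exists2 rho', agree_off Rs rho1 rho' & sat s rho' body.
    split=> [Hpsi|[rho' E /low_xs H]].
      have [rho' [E HC Hd]] := prog_complete P s rho1.
      exists rho' => //; apply/low_xs => s' l.
      have HCs := HC s' l.
      have HgC : sat s' rho' C.
        apply/goalC/negP => /(Hd _ _ _ dr s' l) /EPsi; apply.
        by apply: sat_extW Hpsi _ _ => // x /HN ltxN; rewrite l.
      by split.
    apply: NNPP => npsi.
    have [/goalC/negP HgC _] := H s (fun _ _ => erefl).
    apply: HgC; apply: (prog_sound P (s := s) _ dr) => // [s' /H[]//|].
    apply/EPsi => Hpsi; apply: npsi; apply: sat_extW Hpsi _ _ => // X XQ.
    rewrite E //; apply/negP => /(prog_names P)/andP[]; by rewrite leqNgt Q_lt.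
  rewrite /so_prefix foldr_cat -!/(so_prefix _ _) sat_so_prefix_AllRs //; last first.
    move=> X /ds_ge/andP[leX _]; rewrite mem_free_relvars_prefix.
    by apply: contraTN leX => /andP[/body_lt]; rewrite ltnNge.
  rewrite !sat_AllRs.
  have psE rho' : sat s rho' (so_prefix (zip ps Rs) body) <-> sat s rho' psi.
    rewrite sat_so_prefix_ExRs // ?sat_ExRs ?key // => X /ps_ge/andP[leX _].
    apply: contraTN leX => /body_lt ltX; rewrite -ltnNge; exact: leq_trans ltX (leq_addr _ _).
  split=> H rho' E; last by apply/psE/H => X; rewrite mem_undup; apply: E.
  by apply/psE/H => X; rewrite -mem_undup; apply: E.
Qed.

End Prefix.

Theorem theorem4 (tau : vocabulary) :
  logic_equiv (@so_ehorn_r tau) (@pi11 tau).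
Proof. by split; [apply: so_ehorn_r_le_pi11 | apply: pi11_le_so_ehorn_r]. Qed.
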